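(* Let $G$ be a $\Delta$-pure Garside group of finite type, with Garside structure $(G^+,\Delta)$ and set of simple elements $\mathcal D$. Let $g\in G$ be an element whose axis $\{g^k\langle\Delta\rangle : k\in\mathbb Z\}$ in $\mathcal X$ (or, equivalently, whose axis $\{g^kZ(G) : k\in\mathbb Z\}$ in $\overline\Gamma$) is Morse. Then the axis $\{g^k\langle\Delta\rangle : k\in\mathbb Z\}$ is strongly contracting as a subset of $\mathcal X$, and the axis $\{g^kZ(G) : k\in\mathbb Z\}$ is strongly contracting as a subset of $\overline\Gamma$.
   Context: **Garside groups.** A group $G$ is a Garside group with Garside structure $(G^+,\Delta)$ if $G^+\subset G$ is a submonoid with $G^+\cap (G^+)^{-1}=\{1\}$ and $\Delta\in G^+$ is such that: (1) the partial orders $x\preccurlyeq y\iff x^{-1}y\in G^+$ ($x$ is a prefix of $y$) and $x\succcurlyeq y\iff xy^{-1}\in G^+$ ($y$ is a suffix of $x$) are lattice orders on $G$; (2) $\mathcal D=\{x\in G^+: x\preccurlyeq\Delta\}=\{x\in G^+:\Delta\succcurlyeq x\}$ generates $G^+$ as a monoid and $G$ as a group; (3) for each $x\in G^+\setminus\{1\}$ the number $\sup\{k : x=a_1\cdots a_k,\ a_i\in G^+\setminus\{1\}\}$ is finite. Elements of $\mathcal D$ are called simple. $G$ is of finite type if $\mathcal D$ is finite; then $\tau(g)=\Delta^{-1}g\Delta$ has finite order, denoted $e$. $G$ is $\Delta$-pure if $G^+$ is indecomposable as a Zappa–Szép product, i.e. there are no nontrivial submonoids $A,B\subset G^+$ such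 that every $m\in G^+$ can be written as $m=ab=b'a'$ with unique $a,a'\in A$ and unique $b,b'\in B$; in a $\Delta$-pure Garside group of finite type, $Z(G)=\langle\Delta^e\rangle$. For $g\in G$: $\inf(g)=\max\{r\in\mathbb Z:\Delta^r\preccurlyeq g\}$, and $\underline g=g\Delta^{-\inf(g)}$ is the distinguished representative of the coset $g\langle\Delta\rangle$ (it depends only on the coset). **Graphs.** $\overline\Gamma$ is the Cayley graph of $G/Z(G)$ with respect to the image of $\mathcal D$. $\mathcal X$ is the graph whose vertices are the left cosets $g\langle\Delta\rangle$, $g\in G$, with $g\langle\Delta\rangle$ and $h\langle\Delta\rangle$ joined by an edge iff $\underline g s\in h\langle\Delta\rangle$ for some $s\in\mathcal D\setminus\{1,\Delta\}$. Both carry the graph metric (edges of length 1). **Morse.** Let $(X,d)$ be a metric space. A map $\gamma:\mathbb Z\to X$ (or its image) is Morse if $\gamma$ is a quasi-isometric embedding and for all $\Lambda\ge1$, $K\ge0$ there is a number $M^{(\Lambda,K)}$ such that every $(\Lambda,K)$-quasi-geodesic in $X$ connecting two points of $\gamma(\mathbb Z)$ stays in the $M^{(\Lambda,K)}$-neighbourhood of $\gamma(\mathbb Z)$. The axis of $g$ is Morse if the map $k\mapsto g^k\langle\Delta\rangle$ (resp. $k\mapsto g^kZ(G)$) is Morse. **Strongly contracting.** Let $(X,d)$ be a metric space and $\mathcal A\subset X$. A map $\rho:X\to\mathcal A$ is $C$-strongly contracting ($C\ge0$) if (i) $d(\rho(a),a)\le C$ for all $a\in\mathcal A$; (ii) $d(x,\rho(x))-d(x,\mathcal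 A)\le C$ for all $x\in X$; (iii) for all $u,v\in X$, $d(u,v)<d(v,\mathcal A)-C$ implies $d(\rho(u),\rho(v))\le C$. The subset $\mathcal A$ is strongly contracting if there exist $C\geq 0$ and a $C$-strongly contracting map $X\to\mathcal A$. *)

(* Defs.v *)
From HB Require Import structures.
From mathcomp Require Import all_boot all_order all_algebra.
From mathcomp Require Import all_classical all_reals.

Set Implicit Arguments.
Unset Strict Implicit.
Unset Printing Implicit Defensive.

Import Order.TTheory GRing.Theory Num.Theory.

Local Open Scope classical_set_scope.

Section Metric.
Local Open Scope ring_scope.
Context (R : realType) (X : Type) (d : X -> X -> R).

Definition dist_set (x : X) (A : set X) : R := inf [set d x a | a in A].

Definition quasi_isometric_embedding (gamma : int -> X) : Prop :=
  exists Lambda K : R, [/\ 1 <= Lambda, 0 <= K &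
    forall i j : int,
      Lambda^-1 * `|i - j|%:~R - K <= d (gamma i) (gamma j)
      <= Lambda * `|i - j|%:~R + K].

(* No continuity is required of quasi-geodesics. *)
Definition quasi_geodesic (Lambda K a b : R) (c : R -> X) : Prop :=
  a <= b /\
  forall s t, a <= s <= b -> a <= t <= b ->
    Lambda^-1 * `|s - t| - K <= d (c s) (c t) <= Lambda * `|s - t| + K.

Definition morse (gamma : int -> X) : Prop :=
  quasi_isometric_embedding gamma /\
  forall Lambda K : R, 1 <= Lambda -> 0 <= K ->
    exists M : R, forall (a b : R) (c : R -> X),
      quasi_geodesic Lambda K a b c ->
      range gamma (c a) -> range gamma (c b) ->
      forall t, a <= t <= b -> dist_set (c t) (range gamma) <= M.

Definition strongly_contracting_map (A : set X) (C : R) (rho : X -> X) : Prop :=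
  [/\ forall x, A (rho x),
      forall a, A a -> d (rho a) a <= C,
      forall x, d x (rho x) - dist_set x A <= C &
      forall u v, d u v < dist_set v A - C -> d (rho u) (rho v) <= C].

Definition strongly_contracting (A : set X) : Prop :=
  exists (C : R) (rho : X -> X), 0 <= C /\ strongly_contracting_map A C rho.

End Metric.

(* The undirected graph spanned by a relation [e] on [V], as a metric graph with
   edges of length 1.  A point is given by its barycentric coordinates
   [V -> R], supported on a vertex or on an edge; hence loops and multiple
   edges play no role. *)
Section MetricGraph.
Local Open Scope ring_scope.
Context (R : realType) (V : Type) (e : V -> V -> Prop).

Definition adjacent (u v : V) : Prop := e u v \/ e v u.

Fixpoint walk (n : nat) (u v : V) : Prop :=
  if n is m.+1 then exists2 w, adjacent u w & walk m w v else u = v.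

Definition vertex_dist (u v : V) : R := inf [set n%:R | n in [set n | walk n u v]].

Definition on_segment (u v : V) (x : V -> R) : Prop :=
  exists t : R, 0 <= t <= 1 /\
    forall w, x w = (1 - t) * `[< w = u >]%:R + t * `[< w = v >]%:R.

Definition cell (u v : V) : Prop := u = v \/ adjacent u v.

Definition is_graph_point (x : V -> R) : Prop :=
  exists u v, cell u v /\ on_segment u v x.

Definition metric_graph : Type := {x : V -> R | is_graph_point x}.

(* A vertex [a] with [0 < x a] is an endpoint of the cell carrying [x], and it
   lies at distance [1 - x a] from [x] along this cell.  A shortest path from
   [x] to [y] either stays inside one edge or leaves through endpoints.
   The infimum is over a nonempty set as soon as the graph is connected. *)
Definition graph_dist (x y : metric_graph) : R :=
  inf ([set r | exists u v, [/\ cell u v, on_segment u v (sval x),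
                  on_segment u v (sval y) & r = `|sval x u - sval y u|]]
       `|` [set r | exists a b, [/\ 0 < sval x a, 0 < sval y b &
                  r = (1 - sval x a) + vertex_dist a b + (1 - sval y b)]]).

Lemma vertex_is_graph_point (v : V) :
  is_graph_point (fun w => `[< w = v >]%:R).
Proof.
exists v, v; split; first by left.
by exists 0; rewrite lexx ler01; split => // w; rewrite subr0 mul1r mul0r addr0.
Qed.

Definition vertex (v : V) : metric_graph := exist _ _ (vertex_is_graph_point v).

End MetricGraph.

Section Garside.
Local Open Scope group_scope.
Context (G : groupType).

Definition zpow (x : G) (k : int) : G :=
  match k with Posz n => x ^+ n | Negz n => x ^- n.+1 end.

Definition is_submonoid (M : set G) : Prop :=
  M 1 /\ forall x y, M x -> M y -> M (x * y).

Definition is_subgroup (H : set G) : Prop :=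
  is_submonoid H /\ forall x, H x -> H x^-1.

Definition is_lattice_order (le : G -> G -> Prop) : Prop :=
  [/\ forall x, le x x,
      forall x y, le x y -> le y x -> x = y,
      forall x y z, le x y -> le y z -> le x z,
      forall x y, exists m, [/\ le m x, le m y &
        forall z, le z x -> le z y -> le z m] &
      forall x y, exists j, [/\ le x j, le y j &
        forall z, le x z -> le y z -> le j z]].

Section Structure.
Context (Gp : set G) (Delta : G).

Definition prefix_of (x y : G) : Prop := Gp (x^-1 * y).

Definition suffix_of (y x : G) : Prop := Gp (x * y^-1).

Definition simple_elements : set G := [set x | Gp x /\ prefix_of x Delta].

Record garside_structure : Prop := GarsideStructure {
  garside_submonoid : is_submonoid Gp;
  garside_pointed : forall x, Gp x -> Gp x^-1 -> x = 1;
  garside_Delta : Gp Delta;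
  garside_prefix_lattice : is_lattice_order prefix_of;
  garside_suffix_lattice : is_lattice_order suffix_of;
  garside_balanced : simple_elements = [set x | Gp x /\ suffix_of x Delta];
  garside_gen_monoid : smallest is_submonoid simple_elements = Gp;
  garside_gen_group : smallest is_subgroup simple_elements = setT;
  garside_atomic : forall x, Gp x -> x <> 1 ->
    exists N : nat, forall s : seq G,
      (forall a, a \in s -> Gp a /\ a <> 1) ->
      \prod_(a <- s) a = x -> (size s <= N)%N
}.

Definition finite_type : Prop := finite_set simple_elements.

Definition zappa_szep (A B : set G) : Prop :=
  forall m, Gp m ->
    (exists! p : G * G, [/\ A p.1, B p.2 & m = p.1 * p.2]) /\
    (exists! q : G * G, [/\ B q.1, A q.2 & m = q.1 * q.2]).

Definition Delta_pure : Prop :=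
  ~ exists A B : set G,
      [/\ is_submonoid A /\ is_submonoid B, A `<=` Gp /\ B `<=` Gp,
          A <> [set 1] /\ B <> [set 1] & zappa_szep A B].

(* The exponents [r] with [Delta^r] a prefix of [x] do have a maximum, unless
   [G] is trivial. *)
Definition garside_inf (x : G) : int :=
  xget 0%R [set r | prefix_of (zpow Delta r) x /\
    forall r', prefix_of (zpow Delta r') x -> (r' <= r)%R].

Definition distinguished (x : G) : G := x * zpow Delta (- garside_inf x)%R.

End Structure.

Definition left_coset (H : set G) (x : G) : set G := [set x * h | h in H].

Definition cosets (H : set G) : Type :=
  {A : set G | exists x, A = left_coset H x}.

Definition coset_of (H : set G) (x : G) : cosets H :=
  exist _ (left_coset H x) (ex_intro _ x erefl).

Definition cyclic_subgroup (x : G) : set G := range (zpow x).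

Definition center : set G := [set z | forall x, z * x = x * z].

Context (Gp : set G) (Delta : G).

(* The elements of the group [G / Z(G)] are the left cosets of the center, and
   the product of the classes of [x] and [s] is the class of [x * s]. *)
Definition cayley_edge (u v : cosets center) : Prop :=
  exists x s, [/\ simple_elements Gp Delta s,
    u = coset_of center x & v = coset_of center (x * s)].

Definition X_edge (u v : cosets (cyclic_subgroup Delta)) : Prop :=
  exists x s, [/\ u = coset_of _ x,
    simple_elements Gp Delta s, s <> 1 /\ s <> Delta &
    sval v (distinguished Gp Delta x * s)].

Context (R : realType).

Definition Gamma_bar : Type := metric_graph R cayley_edge.

Definition X_graph : Type := metric_graph R X_edge.

Definition axis_Gamma_bar (g : G) (k : int) : Gamma_bar :=
  vertex R cayley_edge (coset_of center (zpow g k)).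

Definition axis_X (g : G) (k : int) : X_graph :=
  vertex R X_edge (coset_of (cyclic_subgroup Delta) (zpow g k)).

Definition dist_Gamma_bar (p q : Gamma_bar) : R := graph_dist p q.

Definition dist_X (p q : X_graph) : R := graph_dist p q.

End Garside.

(* Main.v *)
Require Import Defs.
From HB Require Import structures.
From mathcomp Require Import all_boot all_order all_algebra.
From mathcomp Require Import all_classical all_reals.
From mathcomp Require Import zify ring lra.

Set Implicit Arguments.
Unset Strict Implicit.
Unset Printing Implicit Defensive.

Import Order.TTheory GRing.Theory Num.Theory.

Local Open Scope ring_scope.

(** Let [delta x y] be the least [b] such that [y] is a prefix of
    [x * Delta ^ b].  Then [d x y = delta x y + delta y x] is a pseudo-distance
    on the group: it measures how far apart the cosets of [x] and [y] modulo the
    powers of [Delta] are.  Up to a bounded error it is the distance of both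
    graphs.  For the Cayley graph of the central quotient this needs the center
    to be bounded for [d], and this is where indecomposability enters: the
    center is finite modulo the powers of [Delta] ([center_finite_mod_Delta]).
    As Morse lines and strongly contracting lines are preserved by maps that distort distances by a bounded additive error
    ([morse_transfer], [strongly_contracting_transfer]), it remains to show that
    a Morse line [gamma] for [d] is strongly contracting for [d].

    The lattice structure of the group says that [delta] of a meet, or to a
    join, is a maximum of two values of [delta]; this, together with the effect
    of multiplication by [Delta], is all that is used ([asymLattice]).  In
    particular the meets of [b] with the shifts of [a] form a geodesic from [a]
    to [b] ([geo]), hence stay near [gamma] when [a] and [b] lie on it.

    The key point is that the asymmetry of [delta] is invisible from [gamma]:
    the two perimeters of a triangle [x], [gamma i], [gamma j], measured by
    [delta] along the two orientations, differ by a bounded amount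
    ([skew_line_cocycle]).  Suppose that they differ by [P].  Then a segment of
    the line of length [P] looks equally far away from [x], and the joins of its
    points with a fixed shift of [x] form a copy of this segment at height [P/4]
    above the line that is no longer than the segment itself.  Together with two
    vertical pieces it is a detour whose length is linear in [P].  Give each step
    that leaves the detour four times the cost of a step inside it.  A path of
    least cost between the ends of the detour is a quasi-geodesic whose
    constants do not depend on [P], so it is near [gamma]; but its cost is too
    small to avoid the upper part of the detour.  Hence [P] is bounded
    ([orientation_upper]).

    From then on the line behaves as in an injective metric space.  A nearest
    point [p] of [x] on the line satisfies [d x p + d p q <= d x q + C] for each
    [q] on the line ([nearest_additive]), and comparing two meets built from
    [u], [v] and the line shows that [u] and [v] have close nearest points when
    [d u v] is at most the distance from [v] to the line
    ([nearest_contracting]). *)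

(** * Lattices with an integral asymmetric distance *)

(** The group with the prefix order is the intended model: [adist x y] is the
    least [b] such that [y] precedes [shift x b].  The last two axioms say that
    [meet] and [join] are the lattice operations, where [y] counts as below [x]
    when [adist x y <= 0]. *)
Record asymLattice (T : Type) := AsymLattice {
  adist : T -> T -> int;
  shift : T -> int -> T;
  meet : T -> T -> T;
  join : T -> T -> T;
  adist_self : forall x, adist x x = 0;
  adist_triangle : forall y x z, adist x z <= adist x y + adist y z;
  adist_shiftl : forall x k y, adist (shift x k) y = adist x y - k;
  adist_shiftr : forall x y k, adist x (shift y k) = adist x y + k;
  adist_meetl : forall x y z,
    adist (meet x y) z = Num.max (adist x z) (adist y z);
  adist_joinr : forall x y z,
    adist z (join x y) = Num.max (adist z x) (adist z y)
}.

(** The opposite order; statements about meets become statements about joins,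
    while [sdist] below does not change. *)
Program Definition dual_lattice T (A : asymLattice T) : asymLattice T :=
  @AsymLattice T (fun x y => adist A y x) (fun x k => shift A x (- k))
    (join A) (meet A) _ _ _ _ _ _.
Next Obligation. by move=> *; exact: adist_self. Qed.
Next Obligation. by move=> * /=; rewrite addrC; exact: adist_triangle. Qed.
Next Obligation. by move=> * /=; exact: adist_shiftr. Qed.
Next Obligation. by move=> * /=; rewrite adist_shiftl opprK. Qed.
Next Obligation. by move=> * /=; exact: adist_joinr. Qed.
Next Obligation. by move=> * /=; exact: adist_meetl. Qed.

Definition sdist T (A : asymLattice T) (x y : T) : int :=
  adist A x y + adist A y x.

Lemma sdist_dual T (A : asymLattice T) : sdist (dual_lattice A) = sdist A.
Proof. by apply/funext => x; apply/funext => y; rewrite /sdist addrC. Qed.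

(** * Morse lines and discrete quasi-geodesics *)
Section CoarseMorse.
Context (T : Type) (d : T -> T -> int) (gamma : int -> T).

Definition near_line (r : int) (x : T) := exists k, d x (gamma k) <= r.

(** A single constant serves as multiplicative and additive constant, since
    only its existence matters. *)
Definition coarse_line := exists L : int, 0 <= L /\
  forall i j : int, `|i - j| <= L * d (gamma i) (gamma j) + L /\
                    d (gamma i) (gamma j) <= L * `|i - j| + L.

Definition discrete_quasi_geodesic (L : int) (n : nat) (z : nat -> T) :=
  forall s t : nat, (s <= t)%N -> (t <= n)%N ->
    d (z s) (z t) <= (t - s)%N%:Z + L /\
    (t - s)%N%:Z <= L * d (z s) (z t) + L.

Definition captures_quasi_geodesics := forall L : int, 0 <= L -> exists M : int,
  0 <= M /\ forall (n : nat) (z : nat -> T), discrete_quasi_geodesic L n z ->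
    near_line L (z 0%N) -> near_line L (z n) ->
    forall t, (t <= n)%N -> near_line M (z t).

Definition coarse_morse := coarse_line /\ captures_quasi_geodesics.

End CoarseMorse.

(** * Geodesics made of meets *)
Section Geodesics.
Context (T : Type) (A : asymLattice T).
Implicit Types (a b x y z p : T) (c s t : int).
Local Notation delta := (adist A).
Local Notation d := (sdist A).

Lemma sdistxx x : d x x = 0.
Proof. by rewrite /sdist adist_self. Qed.

Lemma sdistC x y : d x y = d y x.
Proof. by rewrite /sdist addrC. Qed.

Lemma sdist_ge0 x y : 0 <= d x y.
Proof. by have := adist_triangle A y x x; rewrite adist_self. Qed.

Lemma sdist_triangle y x z : d x z <= d x y + d y z.
Proof.
have := adist_triangle A y x z; have := adist_triangle A y z x.
by rewrite /sdist; lia.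
Qed.

Lemma adist_meet_lel x y : delta x (meet A x y) <= 0.
Proof.
by have := adist_meetl A x y (meet A x y); rewrite adist_self; lia.
Qed.

Lemma adist_meet_ler x y : delta y (meet A x y) <= 0.
Proof.
by have := adist_meetl A x y (meet A x y); rewrite adist_self; lia.
Qed.

Lemma adist_join_lel x y : delta (join A x y) x <= 0.
Proof.
by have := adist_joinr A x y (join A x y); rewrite adist_self; lia.
Qed.

Lemma adist_join_ler x y : delta (join A x y) y <= 0.
Proof.
by have := adist_joinr A x y (join A x y); rewrite adist_self; lia.
Qed.

(** A geodesic from [a] to [b] for [0 <= c <= d a b].  The point [b] is first
    replaced with its lowest shift above [a], and the geodesic ascends from [a]
    to this shift. *)
Definition geo a b c := meet A (shift A b (delta b a)) (shift A a c).

Lemma adist_geol a b c x :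
  delta (geo a b c) x = Num.max (delta b x - delta b a) (delta a x - c).
Proof. by rewrite adist_meetl !adist_shiftl. Qed.

Lemma geoP a b c : 0 <= c <= d a b ->
  [/\ delta a (geo a b c) = c, delta (geo a b c) a = 0,
      delta b (geo a b c) = delta b a & delta (geo a b c) b = delta a b - c].
Proof.
rewrite /sdist => hc.
have h1 : delta (geo a b c) a = 0 by rewrite adist_geol adist_self; lia.
have h2 : delta (geo a b c) b = delta a b - c.
  by rewrite adist_geol adist_self; lia.
have := adist_meet_lel (shift A b (delta b a)) (shift A a c).
have := adist_meet_ler (shift A b (delta b a)) (shift A a c).
rewrite !adist_shiftl -/(geo a b c).
have := adist_triangle A (geo a b c) a b.
have := adist_triangle A (geo a b c) b a.
by split; lia.
Qed.

Lemma adist_geo a b s t : 0 <= s -> s <= t -> t <= d a b ->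
  delta (geo a b s) (geo a b t) = t - s /\ delta (geo a b t) (geo a b s) = 0.
Proof.
move=> h1 h2 h3; rewrite !adist_geol.
have [| e1 _ e2 _] := @geoP a b s; first by lia.
have [| e3 _ e4 _] := @geoP a b t; first by lia.
by rewrite e1 e2 e3 e4; lia.
Qed.

Lemma sdist_geo a b s t : 0 <= s -> s <= t -> t <= d a b ->
  d (geo a b s) (geo a b t) = t - s.
Proof.
by move=> h1 h2 h3; have [e1 e2] := adist_geo h1 h2 h3; rewrite /sdist; lia.
Qed.

Lemma sdist_geo_ends a b c : 0 <= c <= d a b ->
  d a (geo a b c) = c /\ d (geo a b c) b = d a b - c.
Proof. by move=> /geoP[]; rewrite /sdist; lia. Qed.

End Geodesics.

Section MorseLine.
Context (T : Type) (A : asymLattice T) (gamma : int -> T).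
Hypothesis Hm : coarse_morse (sdist A) gamma.
Local Notation delta := (adist A).
Local Notation d := (sdist A).
Local Notation near_line := (near_line d gamma).

Lemma line_index_bound r : exists J : int, 0 <= J /\
  forall i j, d (gamma i) (gamma j) <= r -> `|i - j| <= J.
Proof.
have [[L [L0 HL]] _] := Hm.
exists (L * `|r| + L); split; first by nia.
move=> i j h; have [h1 _] := HL i j; have h2 := sdist_ge0 A (gamma i) (gamma j).
by nia.
Qed.

Lemma line_dist_bound J : exists r : int, 0 <= r /\
  forall i j, `|i - j| <= J -> d (gamma i) (gamma j) <= r.
Proof.
have [[L [L0 HL]] _] := Hm.
exists (L * `|J| + L); split; first by nia.
by move=> i j h; have [_ h1] := HL i j; nia.
Qed.

Lemma geo_near_line : exists M : int, 0 <= M /\ forall i k c,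
  0 <= c <= d (gamma i) (gamma k) -> near_line M (geo A (gamma i) (gamma k) c).
Proof.
have [_ /(_ 1 isT)[M [M0 HM]]] := Hm; exists M; split => // i k c hc.
set a := gamma i; set b := gamma k; rewrite -/a -/b in hc.
have d0 := sdist_ge0 A a b.
have ec : c = `|c|%N%:Z by lia.
rewrite ec; apply: (HM `|d a b|%N (fun t => geo A a b t%:Z)); last by lia.
- move=> s t hs ht; rewrite sdist_geo; lia.
- exists i; rewrite -/a sdistC /=.
  by have [|e _] := @sdist_geo_ends _ A a b 0%N%:Z; lia.
- exists k; rewrite -/b /=.
  by have [|_ e] := @sdist_geo_ends _ A a b `|d a b|%N%:Z; lia.
Qed.

(** A geodesic from [gamma i] to [gamma k] follows the line by small jumps of
    the index, so it passes near every [gamma j] in between. *)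
Lemma line_additive : exists C : int, 0 <= C /\ forall i j k, i <= j <= k ->
  d (gamma i) (gamma j) + d (gamma j) (gamma k) <= d (gamma i) (gamma k) + C.
Proof.
have [M [M0 HM]] := geo_near_line.
have [J [J0 HJ]] := line_index_bound (2 * M + 1).
have [r [r0 Hr]] := line_dist_bound J.
exists (2 * (M + r)); split; first by lia.
move=> i j k hijk.
set a := gamma i; set b := gamma k.
have d0 := sdist_ge0 A a b.
pose z (t : nat) := geo A a b t%:Z.
suff [t [m [ht hm hmj]]] : exists t m, [/\ (t <= `|d a b|)%N,
    d (z t) (gamma m) <= M & `|m - j| <= J].
  have [|e1 e2] := @sdist_geo_ends _ A a b t%:Z; first by lia.
  have h1 := sdist_triangle A (z t) a (gamma j).
  have h2 := sdist_triangle A (z t) (gamma j) b.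
  have h3 := sdist_triangle A (gamma m) (z t) (gamma j).
  have h4 := Hr _ _ hmj.
  rewrite (sdistC A (gamma j) (z t)) in h2.
  by rewrite /z in h1 h2 h3 hm; lia.
apply: contrapT => hno.
(* Otherwise no index near the geodesic ever crosses [j]. *)
have key (t : nat) : (t <= `|d a b|)%N ->
    forall m, d (z t) (gamma m) <= M -> m < j.
  elim: t => [_ m hm|t IH ht m hm].
    rewrite ltNge; apply/negP => hj; apply: hno; exists 0%N, m; split => //.
    have [|e1 e2] := @sdist_geo_ends _ A a b 0%N%:Z; first by lia.
    have h1 := sdist_triangle A (z 0%N) a (gamma m).
    have := HJ i m; rewrite -/a; rewrite /z in h1 hm; lia.
  have [|m' hm'] := HM i k t%:Z; first by rewrite -/a -/b; lia.
  have hlt := IH (ltnW ht) _ hm'.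
  rewrite ltNge; apply/negP => hj; apply: hno; exists t.+1, m; split => //.
  have := @sdist_geo _ A a b t%:Z t.+1%:Z.
  have h1 := sdist_triangle A (z t) (gamma m') (gamma m).
  have h2 := sdist_triangle A (z t.+1) (z t) (gamma m).
  have h3 := HJ m' m.
  rewrite (sdistC A (gamma m') (z t)) in h1; rewrite -/a -/b in hm'.
  by rewrite /z in h1 h2 hm; lia.
have [|_ e] := @sdist_geo_ends _ A a b `|d a b|%N%:Z; first by lia.
by have := key `|d a b|%N (leqnn _) k; rewrite -/b /z; lia.
Qed.

(** If the index found by the Morse property lies outside [[i, k]], additivity
    forces the corresponding point of the line to be close to an end. *)
Lemma geo_near_between : exists C : int, 0 <= C /\ forall i k c, i <= k ->
  0 <= c <= d (gamma i) (gamma k) ->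
  exists l, i <= l <= k /\ d (geo A (gamma i) (gamma k) c) (gamma l) <= C.
Proof.
have [M [M0 HM]] := geo_near_line.
have [C [C0 HC]] := line_additive.
exists (2 * M + C); split; first by lia.
move=> i k c hik hc; have [l hl] := HM _ _ _ hc.
have [e1 e2] := sdist_geo_ends hc.
set m := geo _ _ _ _ in hl e1 e2 *.
have [hli|hil] := ltP l i.
  exists i; have := HC l i k.
  have := sdist_triangle A m (gamma l) (gamma k).
  rewrite (sdistC A (gamma l) m) (sdistC A m (gamma i)).
  have := sdist_triangle A (gamma l) (gamma i) m.
  rewrite (sdistC A (gamma i) (gamma l)) (sdistC A (gamma l) m).
  by lia.
have [hkl|hlk] := ltP k l.
  exists k; have := HC i k l.
  have := sdist_triangle A m (gamma i) (gamma l).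
  have := sdist_triangle A (gamma l) m (gamma k).
  rewrite (sdistC A (gamma l) (gamma k)).
  by lia.
by exists l; lia.
Qed.

(** Up to a shift and a bounded error, [gamma j] is the meet of the shifts of
    [gamma i] and [gamma k] above it, because this meet lies on the geodesic
    [geo] at the position of [gamma j].  Hence [adist] from [gamma j] is
    determined by [adist] from the two ends.  The reverse inequality, without
    error, is the triangle inequality. *)
Lemma adist_between_upper : exists C : int, 0 <= C /\
  forall i j k x, i <= j <= k ->
  delta (gamma j) x <= Num.max (delta (gamma k) x - delta (gamma k) (gamma j))
                               (delta (gamma i) x - delta (gamma i) (gamma j)) + C.
Proof.
have [C1 [C10 HC1]] := line_additive.
have [C2 [C20 HC2]] := geo_near_between.
exists (3 * C1 + 2 * C2); split; first by lia.
move=> i j k x hijk.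
set a := gamma i; set p := gamma j; set b := gamma k.
pose c := delta a p + delta b a - delta b p.
have t1 := adist_triangle A a b p; have t2 := adist_triangle A b a p.
have t3 := adist_triangle A p a b; have t4 := adist_triangle A p b a.
have hc : 0 <= c <= d a b by rewrite /c /sdist; lia.
have [l [hl hlm]] := HC2 i k c ltac:(lia) hc; rewrite -/a -/b in hlm.
have [e1 e2] := sdist_geo_ends hc.
have ep : delta (geo A a b c) p = delta b p - delta b a.
  by rewrite adist_geol /c; lia.
have ex : delta (geo A a b c) x =
   Num.max (delta b x - delta b p) (delta a x - delta a p) + delta b p - delta b a.
  by rewrite adist_geol /c; lia.
set m := geo A a b c in hlm e1 e2 ep ex.
have hadd := HC1 i j k hijk; rewrite -/a -/b -/p in hadd.
have hpm : d p m <= 3 * C1 + 2 * C2.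
  have t5 := sdist_triangle A (gamma l) p m.
  rewrite (sdistC A (gamma l) m) in t5.
  have [hlj|hjl] := leP l j.
    have := HC1 i l j; have := sdist_triangle A (gamma l) a m.
    rewrite (sdistC A (gamma l) m) -/a -/p (sdistC A (gamma l) p).
    rewrite /sdist /c in e1 e2 hlm t5 hadd *; lia.
  have := HC1 j l k; have := sdist_triangle A (gamma l) m b.
  rewrite -/b -/p.
  rewrite /sdist /c in e1 e2 hlm t5 hadd *; lia.
have t6 := adist_triangle A m p x.
rewrite /sdist in hpm; lia.
Qed.

End MorseLine.

Lemma coarse_morse_dual T (A : asymLattice T) gamma :
  coarse_morse (sdist A) gamma -> coarse_morse (sdist (dual_lattice A)) gamma.
Proof. by rewrite sdist_dual. Qed.

Section MorseLineDual.
Context (T : Type) (A : asymLattice T) (gamma : int -> T).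
Hypothesis Hm : coarse_morse (sdist A) gamma.
Local Notation delta := (adist A).

Lemma adist_between_lower : exists C : int, 0 <= C /\
  forall i j k x, i <= j <= k ->
  delta x (gamma j) <= Num.max (delta x (gamma k) - delta (gamma j) (gamma k))
                               (delta x (gamma i) - delta (gamma j) (gamma i)) + C.
Proof. exact: adist_between_upper (coarse_morse_dual Hm). Qed.

End MorseLineDual.

(** * Paths of least weighted cost *)
Section WeightedPaths.
Context (T : Type) (A : asymLattice T) (S : T -> Prop) (w0 : nat).
Local Notation d := (sdist A).

Definition step_cost (x y : T) : nat := if `[< S x /\ S y >] then 1 else w0.

Inductive cost_path : nat -> T -> T -> Prop :=
| cost_nil x : cost_path 0 x x
| cost_snoc c x y z : cost_path c x y -> d y z <= 1 ->
    cost_path (c + step_cost y z) x z.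

Lemma cost_path_trans c1 c2 x y z :
  cost_path c1 x y -> cost_path c2 y z -> cost_path (c1 + c2) x z.
Proof.
move=> h1 h2; elim: h2 h1 => [u|c u v w _ IH hd] h1; first by rewrite addn0.
by rewrite addnA; apply: cost_snoc hd; apply: IH.
Qed.

Lemma cost_path_step x y : d x y <= 1 -> cost_path (step_cost x y) x y.
Proof. by move=> h; rewrite -[step_cost x y]add0n; apply: cost_snoc h; left. Qed.

Lemma cost_path_in n (z : nat -> T) :
  (forall t, (t < n)%N -> d (z t) (z t.+1) <= 1) ->
  (forall t, (t <= n)%N -> S (z t)) -> cost_path n (z 0%N) (z n).
Proof.
elim: n => [_ _|n IH hd hS]; first by left.
have cost1 : step_cost (z n) (z n.+1) = 1%N.
  by rewrite /step_cost asboolT //; split; apply: hS.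
have := cost_snoc (c := n) (x := z 0%N) _ (hd n (ltnSn n)).
rewrite cost1 addn1; apply.
by apply: IH => t ht; [apply: hd|apply: hS]; lia.
Qed.

(** The list form of [cost_path]; [k t] is the cost paid up to [z t]. *)
Definition listed_path n (z : nat -> T) (k : nat -> nat) :=
  k 0%N = 0%N /\ forall t, (t < n)%N ->
    d (z t) (z t.+1) <= 1 /\ k t.+1 = (k t + step_cost (z t) (z t.+1))%N.

Lemma cost_path_listed c x y : cost_path c x y -> exists n z k,
  [/\ listed_path n z k, z 0%N = x, z n = y & k n = c].
Proof.
elim=> [u|{}c u v w _ [n [z [k [[hk0 hz] z0 zn kn]]]] hd].
  by exists 0%N, (fun=> u), (fun=> 0%N).
exists n.+1, (fun t => if (t <= n)%N then z t else w),
  (fun t => if (t <= n)%N then k t else (c + step_cost v w)%N).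
split; [|by []|by rewrite ltnn|by rewrite ltnn].
split=> [//|t ht0]; have [->|ht] : t = n \/ (t < n)%N by lia.
  by rewrite /= leqnn ltnn zn kn.
by rewrite /= ht ltnW //; apply: hz.
Qed.

(** A lower bound for costs: a function that varies only across expensive steps,
    and by at most 1 there, cannot vary much along a cheap path. *)
Lemma listed_path_potential n z k (psi : T -> int) : listed_path n z k ->
  (forall t, (t < n)%N ->
     w0%:Z * (psi (z t.+1) - psi (z t)) <= (step_cost (z t) (z t.+1))%:Z) ->
  w0%:Z * (psi (z n) - psi (z 0%N)) <= (k n)%:Z.
Proof.
move=> [k0 hz] hpsi.
suff: forall t, (t <= n)%N -> w0%:Z * (psi (z t) - psi (z 0%N)) <= (k t)%:Z.
  by apply.
elim=> [_|t IH ht]; first by rewrite k0 subrr mulr0.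
by have := IH (ltnW ht); have := hpsi t ht; have [_ ->] := hz t ht; lia.
Qed.

Hypothesis w0_gt0 : (0 < w0)%N.

Lemma step_cost_le x y : (step_cost x y <= w0)%N.
Proof. by rewrite /step_cost; case: ifP. Qed.

Lemma step_cost_gt0 x y : (0 < step_cost x y)%N.
Proof. by rewrite /step_cost; case: ifP. Qed.

(** The two extra steps join [x] and [y] to the ends of [geo], which are only
    at distance 0 from them. *)
Lemma cost_path_geo x y : exists2 c, cost_path c x y &
  c%:Z <= w0%:Z * (d x y + 2).
Proof.
have d0 := sdist_ge0 A x y.
have key (n : nat) : (n <= `|d x y|)%N ->
    exists2 c, cost_path c x (geo A x y n%:Z) & (c <= w0 * n.+1)%N.
  elim: n => [_|n IH hn].
    exists (step_cost x (geo A x y 0%N%:Z)); last by rewrite muln1 step_cost_le.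
    by apply: cost_path_step; have [|e _] := @sdist_geo_ends _ A x y 0%N%:Z; lia.
  have [c h1 h2] := IH (ltnW hn).
  exists (c + step_cost (geo A x y n%:Z) (geo A x y n.+1%:Z))%N.
    by apply: cost_snoc h1 _; rewrite sdist_geo; lia.
  by have := step_cost_le (geo A x y n%:Z) (geo A x y n.+1%:Z); lia.
have [c h1 h2] := key _ (leqnn _).
exists (c + step_cost (geo A x y `|d x y|%N%:Z) y)%N.
  apply: cost_snoc h1 _.
  by have [|_ e] := @sdist_geo_ends _ A x y `|d x y|%N%:Z; lia.
have := step_cost_le (geo A x y `|d x y|%N%:Z) y.
by move: (step_cost _ _) => e he; nia.
Qed.

Lemma listed_cost_path n z k : listed_path n z k ->
  forall s t, (s <= t)%N -> (t <= n)%N ->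
  (k s <= k t)%N /\ cost_path (k t - k s) (z s) (z t).
Proof.
move=> [_ hz] s t; elim: t => [|t IH].
  by rewrite leqn0 => /eqP -> _; rewrite subnn; split => //; left.
rewrite leq_eqVlt => /orP[/eqP -> _|hs ht].
  by rewrite subnn; split => //; left.
have [h1 h2] := IH hs (ltnW ht); have [h3 h4] := hz t ht.
split; first by lia.
have -> : (k t.+1 - k s = (k t - k s) + step_cost (z t) (z t.+1))%N by lia.
exact: cost_snoc h3.
Qed.

(** Replacing a piece of a cheapest path with a geodesic cannot lower its cost,
    so the number of steps of the piece is bounded linearly by the distance of
    its ends; the constants depend on [w0] only. *)
Lemma cheapest_path c0 x y : cost_path c0 x y -> exists n z k,
  [/\ listed_path n z k, z 0%N = x, z n = y, (k n <= c0)%N &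
    forall s t, (s <= t)%N -> (t <= n)%N ->
      (t - s)%N%:Z <= (2 * w0)%N%:Z * d (z s) (z t) + (2 * w0)%N%:Z].
Proof.
move=> h0.
have hex : exists c, `[< cost_path c x y >] by exists c0; apply/asboolP.
case: (ex_minnP hex) => c /asboolP hc hmin.
have [n [z [k [hl z0 zn kn]]]] := cost_path_listed hc.
exists n, z, k; split => //; first by rewrite kn; apply: hmin; apply/asboolP.
move=> s t hst htn.
have hks : (t - s <= k t - k s)%N.
  have [_ hz] := hl; elim: t hst htn => [|t IH]; first by lia.
  rewrite leq_eqVlt => /orP[/eqP ->|hs ht]; first by lia.
  have [_ e] := hz t ht; have := step_cost_gt0 (z t) (z t.+1).
  have [h _] := listed_cost_path (s := s) (t := t) hl hs (ltnW ht).
  by have := IH hs (ltnW ht); lia.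
have [c' hc' le_c'] := cost_path_geo (z s) (z t).
have [h1 p1] := listed_cost_path hl (leq0n s) (leq_trans hst htn).
have [h2 p2] := listed_cost_path hl htn (leqnn n).
have [h3 _] := listed_cost_path hl hst htn.
have := hmin _ (asboolT (cost_path_trans (cost_path_trans
   (eq_ind _ (fun u => cost_path _ u _) p1 _ z0) hc')
   (eq_ind _ (fun u => cost_path _ _ u) p2 _ zn))).
have [k0 _] := hl; rewrite kn k0.
have d0 := sdist_ge0 A (z s) (z t).
by rewrite kn in h2; nia.
Qed.

End WeightedPaths.

(** * Both orientations of a triangle have nearly the same perimeter *)
Section Detour.
Context (T : Type) (A : asymLattice T) (gamma : int -> T).
Hypothesis Hm : coarse_morse (sdist A) gamma.
Local Notation delta := (adist A).
Local Notation d := (sdist A).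
Local Notation near_line := (near_line d gamma).

(** Since the constants of the quasi-geodesic in [cheapest_path] do not depend on
    the set [S] of cheap points, neither does the Morse constant. *)
Lemma cheapest_path_near (w0 : nat) (E : int) : (0 < w0)%N -> 0 <= E ->
  exists M : int, 0 <= M /\
  forall (S : T -> Prop) c0 x y, cost_path A S w0 c0 x y ->
  near_line E x -> near_line E y -> exists n z k,
  [/\ listed_path A S w0 n z k, z 0%N = x, z n = y, (k n <= c0)%N &
      forall t, (t <= n)%N -> near_line M (z t)].
Proof.
move=> w0_gt0 E0.
have [_ /(_ (2 * w0%:Z + E) ltac:(lia))[M [M0 HM]]] := Hm.
exists M; split => // S c0 x y hc hx hy.
have [n [z [k [hl z0 zn kn hqg]]]] := cheapest_path w0_gt0 hc.
exists n, z, k; split => //; apply: HM.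
- move=> s t hst htn; split; last first.
    by have := hqg s t hst htn; have := sdist_ge0 A (z s) (z t); nia.
  suff: d (z s) (z t) <= (t - s)%N%:Z by lia.
  have [_ hz] := hl.
  elim: t hst htn => [|t IH].
    by rewrite leqn0 => /eqP -> _; rewrite sdistxx.
  rewrite leq_eqVlt => /orP[/eqP -> _|hs ht]; first by rewrite sdistxx.
  have := IH hs (ltnW ht); have [h1 _] := hz t ht.
  by have := sdist_triangle A (z t) (z s) (z t.+1); lia.
- by rewrite z0; have [i hi] := hx; exists i; lia.
- by rewrite zn; have [i hi] := hy; exists i; lia.
Qed.

(** The excess of [x] over the ends of a long piece of the line, in one
    orientation, bounds the distance from [x] to the line from below: inside the
    piece by additivity, and outside because such points are far from
    [gamma 0], hence from [x]. *)
Lemma line_height : exists C : int, 0 <= C /\ forall x, exists N0 : int,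
  0 <= N0 /\ forall N, N0 <= N -> forall k,
  delta (gamma N) x + delta x (gamma (- N)) - delta (gamma N) (gamma (- N))
    <= d (gamma k) x + C.
Proof.
have [C [C0 HC]] := line_additive Hm.
exists C; split => // x.
have [J [J0 HJ]] := line_index_bound Hm (2 * d (gamma 0) x).
exists J; split => // N hN k.
have t1 := adist_triangle A (gamma 0) (gamma N) x.
have t2 := adist_triangle A (gamma 0) x (gamma (- N)).
have t3 := adist_triangle A (gamma 0) (gamma (- N)) (gamma N).
have a1 := HC (- N) 0 N ltac:(lia).
have [hk|hk] := leP (d (gamma k) (gamma 0)) (2 * d (gamma 0) x).
  have hkJ := HJ _ _ hk.
  have a2 := HC (- N) k N ltac:(lia).
  have t4 := adist_triangle A (gamma k) (gamma N) x.
  have t5 := adist_triangle A (gamma k) x (gamma (- N)).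
  have t6 := adist_triangle A (gamma k) (gamma (- N)) (gamma N).
  by rewrite /sdist in a2 *; lia.
have t4 := sdist_triangle A x (gamma k) (gamma 0).
by rewrite /sdist in a1 t4 hk *; lia.
Qed.

(** One half of the comparison of the two perimeters, for long pieces of the
    line.  If it failed by [P], there would be a detour of length linear in [P]
    that contains points at height [P / 4], as explained at the top. *)
Lemma orientation_upper : exists C : int, 0 <= C /\ forall x, exists N0 : int,
  0 <= N0 /\ forall N, N0 <= N ->
  delta (gamma N) x + delta x (gamma (- N)) - delta (gamma N) (gamma (- N)) <=
  delta (gamma (- N)) x + delta x (gamma N) - delta (gamma (- N)) (gamma N) + C.
Proof.
have [C1 [C10 HC1]] := line_height.
have [C2 [C20 HC2]] := geo_near_between Hm.
have [C3 [C30 HC3]] := adist_between_lower Hm.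
have [M [M0 HM]] := @cheapest_path_near 4 C2 isT C20.
exists (4 * (M + C1 + C2 + C3) + 16); split; first by lia.
move=> x; have [N0 [N00 HN0]] := HC1 x; exists N0; split => // N hN.
pose a := gamma (- N); pose b := gamma N; rewrite -/a -/b.
have hgt := HN0 N hN; rewrite -/a -/b in hgt.
have NN : - N <= N by lia.
pose al := delta b x - delta b a; pose al' := delta a x.
pose be := delta x a; pose be' := delta x b + delta b a.
pose L := d a b.
(* Along [geo a b] the distance to [x] is constant up to a bounded error for
   the parameters between [c1] and [c2], and [c2 - c1] is the defect. *)
pose c1 := al' - al; pose c2 := L - (be' - be).
have t1 := adist_triangle A a b x; have t2 := adist_triangle A b a x.
have t3 := adist_triangle A a x b; have t4 := adist_triangle A b x a.
have t5 := adist_triangle A x a b; have t6 := adist_triangle A x b a.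
rewrite leNgt; apply/negP => hP.
pose P := c2 - c1.
have eP : P = (delta b x + delta x a - delta b a) -
              (delta a x + delta x b - delta a b).
  by rewrite /P /c1 /c2 /L /al /al' /be /be' /sdist; lia.
have hP' : 4 * (M + C1 + C2 + C3) + 16 < P by lia.
have c1_ge0 : 0 <= c1 by rewrite /c1 /al /al'; lia.
have c2_leL : c2 <= L by rewrite /c2 /be /be'; lia.
have [h hh] : exists h : nat, h%:Z * 4 <= P < h%:Z * 4 + 4.
  by exists `|(P %/ 4)%Z|%N; lia.
pose f c := geo A a b c.
(* The point at height [i] above [f c], on the way to [x]. *)
pose fu c (i : nat) := join A (f c) (shift A x (i%:Z - al)).
have fx c : c1 <= c -> delta (f c) x = al.
  by rewrite /f adist_geol -/al -/al' /c1; lia.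
have xf c : 0 <= c <= c2 -> delta x (f c) <= be + C2 + C3.
  move=> hc; have hc' : 0 <= c <= d a b by rewrite -/L; lia.
  have [l [hl hlm]] := HC2 _ _ _ NN hc'.
  have := HC3 _ _ _ x hl.
  rewrite -/a -/b -/(f c) in hlm *.
  have [e1 e2 e3 e4] := geoP hc'; rewrite -/(f c) in e1 e2 e3 e4.
  have s1 := adist_triangle A (gamma l) x (f c).
  have s2 := adist_triangle A (gamma l) (f c) a.
  have s3 := adist_triangle A (gamma l) (f c) b.
  by rewrite /c2 /L /be /be' /sdist in hc hlm *; lia.
have ffu c i : c1 <= c -> delta (f c) (fu c i) = i%:Z.
  by move=> hc; rewrite adist_joinr adist_self adist_shiftr fx //; lia.
have fuf c i : delta (fu c i) (f c) <= 0 by apply: adist_join_lel.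
have fux c i : delta (fu c i) x <= al - i%:Z.
  have := adist_join_ler A (f c) (shift A x (i%:Z - al)).
  by rewrite adist_shiftr -/(fu c i); lia.
have vstep c i : c1 <= c -> d (fu c i) (fu c i.+1) <= 1.
  move=> hc; rewrite /sdist ![delta _ (fu _ _)]adist_joinr !adist_shiftr.
  by have := fuf c i; have := fuf c i.+1; have := fux c i; have := fux c i.+1; lia.
have hstep c i : 0 <= c -> c + 1 <= L -> d (fu c i) (fu (c + 1) i) <= 1.
  move=> hc0 hc1.
  have [g1 g2] : delta (f c) (f (c + 1)) = 1 /\ delta (f (c + 1)) (f c) = 0.
    by have := @adist_geo _ A a b c (c + 1) hc0; rewrite -/L -/(f _) -/(f _); lia.
  have q1 := adist_triangle A (f c) (fu c i) (f (c + 1)).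
  have q2 := adist_triangle A (f (c + 1)) (fu (c + 1) i) (f c).
  rewrite /sdist ![delta _ (fu _ _)]adist_joinr !adist_shiftr.
  by have := fuf c i; have := fuf (c + 1) i; have := fux c i; have := fux (c + 1) i; lia.
(* The detour: two vertical pieces [V c1], [V c2] and a horizontal one [H]. *)
pose V c y := exists2 i, (i <= h)%N & y = fu c i.
pose H y := exists2 c, c1 <= c <= c2 & y = fu c h.
pose S y := V c1 y \/ V c2 y \/ H y.
have p1 : cost_path A S 4 h (fu c1 0%N) (fu c1 h).
  apply: cost_path_in => t ht; first by apply: vstep; lia.
  by left; exists t.
have p2 : cost_path A S 4 `|P|%N (fu c1 h) (fu c2 h).
  have e0 : c1 + 0%N%:Z = c1 by lia.
  have e1 : c1 + `|P|%N%:Z = c2 by lia.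
  rewrite -{1}e0 -e1.
  apply: (@cost_path_in _ A S 4 _ (fun t => fu (c1 + t%:Z) h)) => t ht.
    have -> : c1 + t.+1%:Z = c1 + t%:Z + 1 by lia.
    by apply: hstep; lia.
  by right; right; exists (c1 + t%:Z) => //; lia.
have p3 : cost_path A S 4 h (fu c2 h) (fu c2 0%N).
  have := @cost_path_in _ A S 4 h (fun t => fu c2 (h - t)%N).
  rewrite subn0 subnn; apply=> t ht; last first.
    by right; left; exists (h - t)%N => //; rewrite leq_subr.
  have -> : (h - t = (h - t.+1).+1)%N by lia.
  by rewrite sdistC; apply: vstep; lia.
have near0 c : c1 <= c <= c2 -> near_line C2 (fu c 0%N).
  move=> hc.
  have [l [_ hl]] := HC2 _ _ c NN ltac:(rewrite -/a -/b -/L; lia).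
  exists l; rewrite -/a -/b -/(f c) in hl.
  have := sdist_triangle A (f c) (fu c 0%N) (gamma l).
  have := ffu c 0%N ltac:(lia); have := fuf c 0%N; rewrite /sdist in hl *; lia.
have [n [z [k [hl z0 zn kn hnear]]]] :=
  HM S _ _ _ (cost_path_trans (cost_path_trans p1 p2) p3)
    (near0 c1 ltac:(lia)) (near0 c2 ltac:(lia)).
(* Either the cheapest path meets [H], where the height is about [h], or its
   cost is too large since it jumps from [V c1] to [V c2] by expensive steps. *)
have [[t htn [c hc et]]|noH] := pselect (exists2 t, (t <= n)%N & H (z t)).
  have [i] := hnear t htn; rewrite et => hi.
  have := hgt i.
  have q1 := adist_triangle A (fu c h) x (gamma i).
  have q2 := adist_triangle A (fu c h) (gamma i) x.
  have q3 := fux c h.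
  have q4 : delta x (fu c h) = Num.max (delta x (f c)) (h%:Z - al).
    by rewrite adist_joinr adist_shiftr adist_self; lia.
  have := xf c ltac:(lia).
  rewrite /sdist in hi *.
  by rewrite /al /be in q3 q4 *; lia.
have fd : d (f c1) (f c2) = P.
  by rewrite sdist_geo; lia.
have dV c y : c1 <= c -> V c y -> d (f c) y <= h%:Z.
  by move=> hc [i hi ->]; have := fuf c i; have := ffu c i hc; rewrite /sdist; lia.
pose psi y := Num.max h%:Z (Num.min (P - h%:Z) (d (f c1) y)).
have psi1 y : V c1 y -> psi y = h%:Z.
  by move=> /(dV _ _ (lexx _)); rewrite /psi; lia.
have psi2 y : V c2 y -> psi y = P - h%:Z.
  have hc12 : c1 <= c2 by lia.
  move=> /(dV _ _ hc12); rewrite /psi.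
  have := sdist_triangle A y (f c1) (f c2).
  by rewrite (sdistC A y (f c2)); lia.
have : 4%N%:Z * (psi (z n) - psi (z 0%N)) <= (k n)%:Z.
  apply: (listed_path_potential (psi := psi) hl) => s hs.
  have [_ hz] := hl; have [hd _] := hz s hs.
  have q1 := sdist_triangle A (z s) (f c1) (z s.+1).
  rewrite /step_cost; case: asboolP => [[hS1 hS2]|_]; last by rewrite /psi; lia.
  have nH u : (u <= n)%N -> ~ H (z u) by move=> hu hH; apply: noH; exists u.
  case: hS1 => [v1|[v1|/(nH s (ltnW hs))//]].
    case: hS2 => [v2|[v2|/(nH s.+1 hs)//]]; first by rewrite !psi1 //; lia.
    have := psi1 _ v1; have := psi2 _ v2; rewrite /psi; lia.
  case: hS2 => [v2|[v2|/(nH s.+1 hs)//]]; last by rewrite !psi2 //; lia.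
  by rewrite (psi1 _ v2) (psi2 _ v1); lia.
have e1 : psi (fu c1 0%N) = h%:Z by apply: psi1; exists 0%N.
have e2 : psi (fu c2 0%N) = P - h%:Z by apply: psi2; exists 0%N.
by rewrite z0 zn e1 e2; lia.
Qed.

End Detour.

Section OrientationDual.
Context (T : Type) (A : asymLattice T) (gamma : int -> T).
Hypothesis Hm : coarse_morse (sdist A) gamma.
Local Notation delta := (adist A).

(** The other half of the comparison, from [orientation_upper] in the dual
    lattice. *)
Lemma orientation_lower : exists C : int, 0 <= C /\ forall x, exists N0 : int,
  0 <= N0 /\ forall N, N0 <= N ->
  delta (gamma (- N)) x + delta x (gamma N) - delta (gamma (- N)) (gamma N) <=
  delta (gamma N) x + delta x (gamma (- N)) - delta (gamma N) (gamma (- N)) + C.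
Proof.
have [C [C0 HC]] := orientation_upper (coarse_morse_dual Hm).
exists C; split => // x; have [N0 [N00 HN]] := HC x; exists N0; split => // N.
by move=> /HN /=; lia.
Qed.

End OrientationDual.

(** * Nearest points on a Morse line *)
Section Contraction.
Context (T : Type) (A : asymLattice T) (gamma : int -> T).
Hypothesis Hm : coarse_morse (sdist A) gamma.
Local Notation delta := (adist A).
Local Notation d := (sdist A).

Definition skew (x y : T) : int := delta x y - delta y x.

(** The sum is the difference of the two perimeters of a triangle with two
    vertices on the line.  For the ends [a], [b] of a long piece of the line it is
    bounded by [orientation_upper] and its dual.  For a point [p] between them,
    [adist] from and to [p] are maxima over [a] and [b], and the bound for
    [a], [b] says that both maxima choose the same end.  This bounds the sum for
    [a], [p]; the sum is additive under gluing triangles, and it is bounded for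
    triangles on the line by additivity. *)
Lemma skew_line_cocycle : exists C : int, 0 <= C /\ forall x i j,
  `|skew (gamma i) x + skew x (gamma j) + skew (gamma j) (gamma i)| <= C.
Proof.
have [C1 [C10 HC1]] := line_additive Hm.
have [C2 [C20 HC2]] := adist_between_upper Hm.
have [C3 [C30 HC3]] := adist_between_lower Hm.
have [C4 [C40 HC4]] := orientation_upper Hm.
have [C5 [C50 HC5]] := orientation_lower Hm.
pose D := 4 * C1 + C2 + C3 + C4 + C5.
exists (2 * D + 4 * C1); split => [|x i j]; first by lia.
have [N1 [N10 HN1]] := HC4 x; have [N2 [N20 HN2]] := HC5 x.
pose N := N1 + N2 + `|i| + `|j|.
have hN1 := HN1 N ltac:(lia); have hN2 := HN2 N ltac:(lia).
pose a := gamma (- N); pose b := gamma N; rewrite -/a -/b in hN1 hN2.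
have key k : - N <= k <= N ->
    `|skew (gamma k) x - skew a x - skew (gamma k) a| <= D.
  move=> hk.
  have := HC1 (- N) k N hk; have := HC2 (- N) k N x hk; have := HC3 (- N) k N x hk.
  rewrite -/a -/b; move: (gamma k) => p.
  have := adist_triangle A a p x; have := adist_triangle A b p x.
  have := adist_triangle A a x p; have := adist_triangle A b x p.
  have := adist_triangle A p a x; have := adist_triangle A p b x.
  have := adist_triangle A p x a; have := adist_triangle A p x b.
  have := adist_triangle A p a b; have := adist_triangle A p b a.
  by rewrite /skew /sdist; lia.
have ki := key i ltac:(lia); have kj := key j ltac:(lia).
have kij : `|skew (gamma i) a + skew a (gamma j) + skew (gamma j) (gamma i)| <= 4 * C1.
  have [ij|ji] := leP i j.
    have := HC1 (- N) i j ltac:(lia); rewrite -/a.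
    have := adist_triangle A (gamma i) a (gamma j).
    have := adist_triangle A (gamma i) (gamma j) a.
    by rewrite /skew /sdist; lia.
  have := HC1 (- N) j i ltac:(lia); rewrite -/a.
  have := adist_triangle A (gamma j) a (gamma i).
  have := adist_triangle A (gamma j) (gamma i) a.
  by rewrite /skew /sdist; lia.
by rewrite /skew in ki kj kij *; lia.
Qed.

(** By [skew_line_cocycle] the two maxima that compute [adist] from and to
    [gamma l] choose the same end, so their sum is again a maximum. *)
Lemma sdist_between : exists C : int, 0 <= C /\ forall x i l j, i <= l <= j ->
  d x (gamma l) <= Num.max (d x (gamma i) - d (gamma i) (gamma l))
                           (d x (gamma j) - d (gamma l) (gamma j)) + C.
Proof.
have [C1 [C10 HC1]] := skew_line_cocycle.
have [C2 [C20 HC2]] := adist_between_upper Hm.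
have [C3 [C30 HC3]] := adist_between_lower Hm.
exists (2 * C1 + C2 + C3); split => [|x i l j h]; first by lia.
have := HC1 x i j; have := HC1 (gamma l) i j.
have := HC2 i l j x h; have := HC3 i l j x h.
by rewrite /skew /sdist; lia.
Qed.

Definition nearest (x : T) (i : int) :=
  forall k, d x (gamma i) <= d x (gamma k).

Lemma nearest_exists x : exists i, nearest x i.
Proof.
have hex : exists n : nat, `[< exists i, d x (gamma i) = n%:Z >].
  exists `|d x (gamma 0)|%N; apply/asboolP; exists 0.
  by have := sdist_ge0 A x (gamma 0); lia.
case: (ex_minnP hex) => n /asboolP[i hi] hmin; exists i => k.
have := sdist_ge0 A x (gamma k) => d0.
have := hmin `|d x (gamma k)|%N (asboolT _).
by move=> /(_ ltac:(exists k; lia)); lia.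
Qed.

(** Apply [sdist_between] to a point [gamma l] at a fixed large distance from
    [gamma i] in the direction of [gamma j].  As [gamma i] is nearest, the branch
    of the maximum that comes from [gamma i] is impossible. *)
Lemma nearest_additive : exists C : int, 0 <= C /\ forall x i j, nearest x i ->
  d x (gamma i) + d (gamma i) (gamma j) <= d x (gamma j) + C.
Proof.
have [C [C0 HC]] := sdist_between.
have [J [J0 HJ]] := line_index_bound Hm C.
have [r [r0 Hr]] := line_dist_bound Hm (J + 1).
exists (r + C); split => [|x i j hi]; first by lia.
have [hij|hij] := leP `|i - j| J.
  by have := hi j; have := Hr i j; lia.
have [l hl hlj] : exists2 l,
    `|i - l| = J + 1 & (i <= l <= j) || (j <= l <= i).
  have [h|h] := leP i j; first by exists (i + (J + 1)); lia.
  by exists (i - (J + 1)); lia.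
have h1 := hi l; have h2 := HJ i l; have h3 := Hr i l.
have h4 := sdist_triangle A (gamma l) (gamma i) (gamma j).
have [h|h] := orP hlj.
  by have := HC x i l j h; lia.
have := HC x j l i h.
rewrite (sdistC A (gamma l) (gamma i)) (sdistC A (gamma j) (gamma l)).
by lia.
Qed.

(** Write [p] and [q] for the nearest points of [u] and [v], and let [p'] be the
    lowest shift of [p] that lies above [v] in the order [adist p' v <= 0].  The
    meet [z] of [p'] with the shift of [v] by its distance to the line is close
    to the line, namely to [q].  The meet [w] of [p'] with the lowest shift of [u]
    above [v] is as high above [p] as [p'] is.  If [d u v] is at most the distance
    from [v] to the line then [w] lies below [z], which bounds [adist q w].  By
    [skew_line_cocycle] this is also a bound for [adist p w], and it contradicts
    the height of [w] when [p] and [q] are far apart. *)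
Lemma nearest_contracting : exists C : int, 0 <= C /\
  forall u v i j, nearest u i -> nearest v j ->
  d u v <= d v (gamma j) -> d (gamma i) (gamma j) <= C.
Proof.
have [C1 [C10 HC1]] := nearest_additive.
have [C2 [C20 HC2]] := skew_line_cocycle.
exists (10 * C1 + 10 * C2); split => [|u v i j hu hv]; first by lia.
have a1 := HC1 u i j hu; have a2 := HC1 v j i hv.
have su := HC2 u i j; have sv := HC2 v i j.
pose z := meet A (shift A (gamma i) (delta (gamma i) v)) (shift A v (d v (gamma j))).
pose w := meet A (shift A (gamma i) (delta (gamma i) v)) (shift A u (delta u v)).
have sz := HC2 z i j; have sw := HC2 w i j.
have zE y : delta z y = Num.max (delta (gamma i) y - delta (gamma i) v)
    (delta v y - d v (gamma j)) by rewrite adist_meetl !adist_shiftl.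
have wE y : delta w y = Num.max (delta (gamma i) y - delta (gamma i) v)
    (delta u y - delta u v) by rewrite adist_meetl !adist_shiftl.
have ww := wE w; rewrite adist_self in ww; clearbody w z.
move: (gamma i) (gamma j) ww a1 a2 su sv sz sw zE wE.
move=> p q ww a1 a2 su sv sz sw zE wE h.
have zw : delta z w <= 0.
  by rewrite zE; have := adist_triangle A u v w; rewrite /sdist in h *; lia.
have := zE z; have := adist_triangle A z q w; have := adist_triangle A z p w.
have := adist_triangle A w p u; have := adist_triangle A u p v.
have := adist_triangle A p v u; have := adist_triangle A v u p.
have := adist_triangle A v u q; have := adist_triangle A u v q.
have := adist_triangle A u v p.
rewrite adist_self.
have := wE u; have := wE p; have := wE q; have := zE p; have := zE q.
have := sdist_ge0 A p q; have := sdist_ge0 A u v.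
rewrite !adist_self.
rewrite /skew /sdist in h a1 a2 su sv sz sw *.
lia.
Qed.

End Contraction.

Local Open Scope classical_set_scope.
Local Open Scope ring_scope.

(** * Transfer along coarse isometries *)
Section CoarseMetric.
Context (R : realType).

(** The metric axioms with an additive error; graph distances are only compared
    with the distance of the group up to such an error. *)
Definition coarse_metric X (C : R) (d : X -> X -> R) := [/\ 0 <= C,
  forall x y, - C <= d x y, forall x, d x x <= C, forall x y, d x y <= d y x + C &
  forall y x z, d x z <= d x y + d y z + C].

Section OneSpace.
Context (X : Type) (C : R) (d : X -> X -> R) (gamma : int -> X).
Hypothesis Hd : coarse_metric C d.

Lemma dist_set_le x k : dist_set d x (range gamma) <= d x (gamma k).
Proof.
have [_ h _ _ _] := Hd.
apply: ge_inf; last by exists (gamma k) => //; exists k.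
by exists (- C) => _ [a _ <-]; apply: h.
Qed.

Lemma dist_set_ge x m : (forall k, m <= d x (gamma k)) ->
  m <= dist_set d x (range gamma).
Proof.
move=> h; apply: lb_le_inf; last by move=> _ [_ [k _ <-] <-]; apply: h.
by exists (d x (gamma 0)), (gamma 0) => //; exists 0.
Qed.

Lemma dist_set_near x m : dist_set d x (range gamma) <= m ->
  exists k, d x (gamma k) <= m + 1.
Proof.
move=> h; apply: contrapT => hno.
have : m + 1 <= dist_set d x (range gamma).
  apply: dist_set_ge => k; rewrite leNgt; apply/negP => hk.
  by apply: hno; exists k; apply: ltW.
by lra.
Qed.

(** Moving the two ends of a quasi-geodesic onto the line only changes its
    additive constant. *)
Lemma morse_near_ends : morse d gamma -> forall Lambda K : R,
  1 <= Lambda -> 0 <= K -> exists M : R, forall (a b : R) (c : R -> X),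
  quasi_geodesic d Lambda K a b c ->
  (exists i, d (c a) (gamma i) <= K) -> (exists j, d (c b) (gamma j) <= K) ->
  forall t, a <= t <= b -> exists k, d (c t) (gamma k) <= M.
Proof.
have [C0 dge dxx dsym dtri] := Hd.
move=> [_ hM] Lambda K L1 K0.
have [M HM] := hM Lambda (K + 2 * (K + 3 * C)) L1 ltac:(lra).
exists (M + 1 + K + 2 * C) => a b c [ab hc] [i hi] [j hj].
pose c' t := if t == a then gamma i else if t == b then gamma j else c t.
have close t : d (c' t) (c t) <= K + C /\ d (c t) (c' t) <= K + C.
  rewrite /c'; case: eqP => [->|_]; first by have := dsym (gamma i) (c a); lra.
  case: eqP => [->|_]; first by have := dsym (gamma j) (c b); lra.
  by have := dxx (c t); lra.
move=> t ht.
have [|k hk] := @dist_set_near (c' t) M; last first.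
- exists k; have := dtri (c' t) (c t) (gamma k); have [_] := close t; lra.
- apply: (HM a b c') => //.
  + split => // s u hs hu; have [h1 h2] := close s; have [h3 h4] := close u.
    have := hc s u hs hu.
    have := dtri (c s) (c' s) (c' u); have := dtri (c u) (c s) (c' u).
    have := dtri (c' s) (c s) (c u); have := dtri (c' u) (c' s) (c u); lra.
  + by rewrite /c' eqxx; exists i.
  + by rewrite /c' eqxx; case: ifP => _; [exists i|exists j].
Qed.

End OneSpace.

Section Transfer.
Context (X X' : Type) (C : R) (d : X -> X -> R) (d' : X' -> X' -> R).
Hypotheses (Hd : coarse_metric C d) (Hd' : coarse_metric C d').

Lemma morse_transfer (f : X' -> X) (gamma : int -> X) (gamma' : int -> X') :
  (forall x y, `|d (f x) (f y) - d' x y| <= C) ->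
  (forall k, d (f (gamma' k)) (gamma k) <= C) ->
  morse d gamma -> morse d' gamma'.
Proof.
have [C0 dge dxx dsym dtri] := Hd; have [_ dge' dxx' dsym' dtri'] := Hd'.
move=> hf hg hm.
have hf1 x y : d (f x) (f y) <= d' x y + C
  by move: (hf x y); rewrite ler_norml => /andP[]; lra.
have hf2 x y : d' x y <= d (f x) (f y) + C
  by move: (hf x y); rewrite ler_norml => /andP[]; lra.
split.
  have [[L [K [L1 K0 HLK]]] _] := hm.
  exists L, (K + 7 * C); split => //; first by lra.
  move=> i j; have := HLK i j.
  have := hg i; have := hg j.
  have := dsym (gamma i) (f (gamma' i)); have := dsym (gamma j) (f (gamma' j)).
  have := dtri (f (gamma' i)) (gamma i) (gamma j).
  have := dtri (f (gamma' j)) (f (gamma' i)) (gamma j).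
  have := dtri (gamma i) (f (gamma' i)) (f (gamma' j)).
  have := dtri (gamma j) (gamma i) (f (gamma' j)).
  have := hf1 (gamma' i) (gamma' j); have := hf2 (gamma' i) (gamma' j).
  lra.
move=> L K L1 K0.
have [M HM] := morse_near_ends Hd hm L1 (addr_ge0 K0 C0).
exists (M + 4 * C) => a b c [ab hc] [i _ hi] [j _ hj] t ht.
have [|||k hk] := HM a b (f \o c) _ _ _ t ht.
- split => // s u hs hu; have := hc s u hs hu.
  by have := hf1 (c s) (c u); have := hf2 (c s) (c u); rewrite /=; lra.
- by exists i; rewrite /= -hi; have := hg i; lra.
- by exists j; rewrite /= -hj; have := hg j; lra.
have := @dist_set_le _ _ _ gamma' Hd' (c t) k.
have := hf2 (c t) (gamma' k); have := hg k; rewrite /= in hk.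
have := dtri (gamma k) (f (c t)) (f (gamma' k)).
by have := dsym (gamma k) (f (gamma' k)); lra.
Qed.

Lemma strongly_contracting_transfer (f : X -> X') (gamma : int -> X)
    (gamma' : int -> X') :
  (forall x y, `|d' (f x) (f y) - d x y| <= C) ->
  (forall k, d' (f (gamma k)) (gamma' k) <= C) ->
  strongly_contracting d' (range gamma') -> strongly_contracting d (range gamma).
Proof.
have [C0 dge dxx dsym dtri] := Hd; have [_ dge' dxx' dsym' dtri'] := Hd'.
move=> hf hg [D [rho' [D0 [rho1 rho2 rho3 rho4]]]].
have hf1 x y : d' (f x) (f y) <= d x y + C
  by move: (hf x y); rewrite ler_norml => /andP[]; lra.
have hf2 x y : d x y <= d' (f x) (f y) + C
  by move: (hf x y); rewrite ler_norml => /andP[]; lra.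
have /choice[idx hidx] : forall x, exists k, rho' (f x) = gamma' k.
  by move=> x; have [k _ hk] := rho1 (f x); exists k.
have cmp1 x k : d x (gamma k) <= d' (f x) (gamma' k) + 4 * C.
  have := hf2 x (gamma k); have := hg k.
  have := dtri' (gamma' k) (f x) (f (gamma k)).
  by have := dsym' (gamma' k) (f (gamma k)); lra.
have cmp2 x k : d' (f x) (gamma' k) <= d x (gamma k) + 4 * C.
  have := hf1 x (gamma k); have := hg k.
  have := dtri' (f (gamma k)) (f x) (gamma' k); lra.
have set1 x : dist_set d x (range gamma) <= dist_set d' (f x) (range gamma') + 4 * C.
  rewrite -lerBlDr; apply: dist_set_ge => k.
  by have := @dist_set_le _ _ _ gamma Hd x k; have := cmp1 x k; lra.
have set2 x : dist_set d' (f x) (range gamma') <= dist_set d x (range gamma) + 4 * C.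
  rewrite -lerBlDr; apply: dist_set_ge => k.
  by have := @dist_set_le _ _ _ gamma' Hd' (f x) k; have := cmp2 x k; lra.
exists (D + 10 * C), (fun x => gamma (idx x)); split; first by lra.
split => [x|_ [k _ <-]|x|u v huv]; first by exists (idx x).
- have h1 := rho3 (f (gamma k)); rewrite hidx in h1.
  have h2 := @dist_set_le _ _ _ gamma' Hd' (f (gamma k)) k.
  have := cmp1 (gamma k) (idx (gamma k)); have := hg k.
  by have := dsym (gamma (idx (gamma k))) (gamma k); lra.
- have := rho3 (f x); rewrite hidx.
  by have := cmp1 x (idx x); have := set2 x; lra.
- have : d' (f u) (f v) < dist_set d' (f v) (range gamma') - D.
    by have := hf1 u v; have := set1 v; lra.
  move=> /rho4; rewrite !hidx => h.
  have := cmp1 (gamma (idx u)) (idx v); have := hg (idx u).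
  by have := dtri' (gamma' (idx u)) (f (gamma (idx u))) (gamma' (idx v)); lra.
Qed.

End Transfer.

Section IntegerMetric.
Context (T : Type) (A : asymLattice T) (gamma : int -> T).
Local Notation d := (sdist A).

Definition rdist (x y : T) : R := (d x y)%:~R.

Lemma rdist_le x y (m : int) : (rdist x y <= m%:~R) = (d x y <= m).
Proof. by rewrite ler_int. Qed.

Lemma coarse_metric_rdist C : 0 <= C -> coarse_metric C rdist.
Proof.
move=> C0; have d0 x y : 0 <= rdist x y by rewrite ler0z sdist_ge0.
split => // [x y|x|x y|y x z].
- by have := d0 x y; lra.
- by rewrite /rdist sdistxx.
- by rewrite /rdist sdistC; lra.
- have : rdist x z <= rdist x y + rdist y z.
    by rewrite /rdist -intrD ler_int sdist_triangle.
  lra.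
Qed.

Lemma int_bound (x : R) : exists n : int, 0 <= n /\ x <= n%:~R.
Proof.
exists (Num.bound `|x|)%:Z; split => //.
by rewrite -pmulrn; have := archi_boundP (normr_ge0 x); have := ler_norm x; lra.
Qed.

(** A discrete path is turned into a path over the reals by rounding the
    parameter down. *)
Lemma coarse_morse_rdist : morse rdist gamma -> coarse_morse d gamma.
Proof.
move=> hm; have hd : coarse_metric 0 rdist by apply: coarse_metric_rdist.
split.
  have [[L [K [L1 K0 HLK]]] _] := hm.
  have [n [n0 hn]] := int_bound (L + K + L * K).
  exists n; split => // i j; have /andP[h1 h2] := HLK i j.
  have LK0 : 0 <= L * K by apply: mulr_ge0; lra.
  rewrite -rdist_le -(ler_int R) intrD intrM -/(rdist _ _).
  rewrite (intrD _ (n * _)) intrM.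
  have e0 : 0 <= rdist (gamma i) (gamma j) by rewrite ler0z sdist_ge0.
  have a0 : 0 <= `|i - j|%:~R :> R by rewrite ler0z normr_ge0.
  move: h1 h2 e0 a0; move: (rdist _ _) (`|i - j|%:~R : R) (n%:~R : R) hn => r a N hN.
  rewrite lerBlDr ler_pdivrMl; last by lra.
  move=> h1 h2 e0 a0.
  have q1 : 0 <= (N - L) * r by apply: mulr_ge0 => //; lra.
  have q2 : 0 <= (N - L) * a by apply: mulr_ge0 => //; lra.
  by split; lra.
move=> L L0.
have LR0 : 0 <= L%:~R :> R by rewrite ler0z.
have [||M HM] := morse_near_ends hd hm (Lambda := L%:~R + 1) (K := 3 * L%:~R + 3).
- by lra.
- by lra.
have [N [N0 hN]] := int_bound M; exists N; split => // n z hz [i hi] [j hj] t ht.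
have [||||k hk] := HM 0 n%:R (fun r => z (Num.truncn r)) _ _ _ t%:R.
- split => // s u hs hu.
  wlog su : s u hs hu / s <= u.
    move=> hw; have [su|us] := leP s u; first exact: hw.
    by rewrite distrC /rdist sdistC; apply: hw => //; apply: ltW.
  have /andP[s0 _] := hs; have /andP[u0 un] := hu.
  have /andP[s1 s2] := truncn_itv s0; have /andP[u1 u2] := truncn_itv u0.
  have hsu : (Num.truncn s <= Num.truncn u)%N by apply: le_truncn.
  have hun : (Num.truncn u <= n)%N by have := le_truncn un; rewrite natrK.
  have [] := hz _ _ hsu hun.
  rewrite -rdist_le -(ler_int R) !intrD intrM -/(rdist _ _).
  rewrite -!pmulrn natrB // !mulrSr in s2 u2 *.
  have r0 : 0 <= rdist (z (Num.truncn s)) (z (Num.truncn u)).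
    by rewrite ler0z sdist_ge0.
  move: r0; move: (rdist _ _) => r r0 h1 h2.
  have -> : `|s - u| = u - s by rewrite distrC ger0_norm // subr_ge0.
  have q1 := mulr_ge0 LR0 r0; have q2 := mulr_ge0 LR0 LR0.
  have q3 : 0 <= L%:~R * (u - s) by apply: mulr_ge0 => //; lra.
  apply/andP; split; last by lra.
  by rewrite lerBlDr ler_pdivrMl; lra.
- exists i; rewrite truncn0; move: hi; rewrite -(ler_int R) -/(rdist _ _); lra.
- exists j; rewrite natrK; move: hj; rewrite -(ler_int R) -/(rdist _ _); lra.
- by rewrite ler0n ler_nat.
rewrite natrK in hk; exists k; rewrite -(ler_int R) -/(rdist _ _).
exact: le_trans hk hN.
Qed.

Lemma strongly_contracting_rdist : coarse_morse d gamma ->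
  strongly_contracting rdist (range gamma).
Proof.
move=> hm; have hd : coarse_metric 0 rdist by apply: coarse_metric_rdist.
have [C [C0 HC]] := nearest_contracting hm.
have /choice[idx hidx] := nearest_exists A gamma.
have hset x : dist_set rdist x (range gamma) = rdist x (gamma (idx x)).
  apply/eqP; rewrite eq_le (dist_set_le gamma hd) /=; apply: dist_set_ge => k.
  by rewrite ler_int; apply: hidx.
exists C%:~R, (fun x => gamma (idx x)); split; first by rewrite ler0z.
split => [x|_ [k _ <-]|x|u v].
- by exists (idx x).
- rewrite rdist_le sdistC; apply: le_trans (hidx _ k) _.
  by rewrite sdistxx.
- by rewrite hset subrr ler0z.
- rewrite hset => h; rewrite rdist_le; apply: HC (hidx u) (hidx v) _.
  have CR0 : 0 <= C%:~R :> R by rewrite ler0z.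
  by rewrite -(ler_int R) -/(rdist _ _) -/(rdist _ _); lra.
Qed.

End IntegerMetric.
End CoarseMetric.

(** * Garside groups as lattices with an asymmetric distance *)
Local Close Scope ring_scope.
Local Open Scope group_scope.

Ltac group_simp :=
  rewrite ?(invgM, invgK, invg1, =^~ mulgA, mulKg, mulVKg, mulgV, mulVg,
            mulg1, mul1g).

Section IntegerPowers.
Context (G : groupType).
Implicit Types (x y : G) (i j k : int).

Lemma zpow_nat x (n : nat) : zpow x n%:Z = x ^+ n.
Proof. by []. Qed.

Lemma zpow0 x : zpow x 0 = 1.
Proof. by []. Qed.

Lemma zpow1 x : zpow x 1 = x.
Proof. by []. Qed.

Lemma zpowS x k : zpow x (k + 1)%R = zpow x k * x.
Proof.
case: k => [n|[|n]]; first by rewrite -PoszD /= addn1 expgSr.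
  by rewrite /= expg1 mulVg.
have -> : (Negz n.+1 + 1)%R = Negz n by rewrite !NegzE; lia.
by rewrite /= (expgS x n.+1); group_simp.
Qed.

Lemma zpowD x i j : zpow x (i + j)%R = zpow x i * zpow x j.
Proof.
have pos (n : nat) k : zpow x (k + n%:Z)%R = zpow x k * zpow x n%:Z.
  elim: n k => [|n IH] k; first by rewrite addr0 zpow0 mulg1.
  rewrite -addn1 PoszD addrA zpowS IH.
  have -> : zpow x (n%:Z + 1)%R = zpow x n%:Z * x by exact: zpowS.
  by rewrite mulgA.
case: j => [n|n]; first exact: pos.
have := pos n.+1 (i + Negz n)%R.
have -> : (i + Negz n + n.+1%:Z)%R = i by rewrite NegzE; lia.
by move=> ->; rewrite /=; group_simp.
Qed.

Lemma zpowN x k : zpow x (- k)%R = (zpow x k)^-1.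
Proof.
have := zpowD x (- k)%R k; rewrite addNr zpow0 => h.
by rewrite -[LHS](mulgK (zpow x k)) -h mul1g.
Qed.

Lemma commute_zpow x y k : x * y = y * x -> x * zpow y k = zpow y k * x.
Proof.
move=> h; have hn (n : nat) : x * y ^+ n = y ^+ n * x by apply: commuteX.
case: k => n /=; first exact: hn.
by apply: (mulgI (y ^+ n.+1)); apply: (mulIg (y ^+ n.+1)); group_simp; rewrite hn.
Qed.

Lemma zpowM x i (n : nat) : zpow x (i * n%:Z)%R = zpow x i ^+ n.
Proof.
elim: n => [|n IH]; first by rewrite mulr0.
by rewrite expgSr -IH -zpowD; congr (zpow x _); lia.
Qed.

End IntegerPowers.

Lemma pigeonhole_seq (T : eqType) (l : seq T) (f : nat -> T) :
  (forall n, f n \in l) -> exists i j, (i < j)%N /\ f i = f j.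
Proof.
move=> hf; apply: contrapT => hno.
have hu : uniq [seq f i | i <- iota 0 (size l).+1].
  rewrite map_inj_in_uniq ?iota_uniq // => i j _ _ fij.
  have [ij|ji|//] := ltngtP i j; exfalso; apply: hno.
    by exists i, j.
  by exists j, i.
have sub : {subset [seq f i | i <- iota 0 (size l).+1] <= l}.
  by move=> _ /mapP[i _ ->].
by have := uniq_leq_size hu sub; rewrite size_map size_iota ltnn.
Qed.

Section GarsideBasics.
Context (G : groupType) (Gp : set G) (Delta : G).
Hypothesis HG : garside_structure Gp Delta.
Local Notation le := (prefix_of Gp).
Local Notation D := (zpow Delta).

Lemma Gp1 : Gp 1.
Proof. by have [] := garside_submonoid HG. Qed.

Lemma GpM x y : Gp x -> Gp y -> Gp (x * y).
Proof. by have [_ h] := garside_submonoid HG; apply: h. Qed.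

Lemma GpX x n : Gp x -> Gp (x ^+ n).
Proof. by move=> h; elim: n => [|n IH]; [exact: Gp1|rewrite expgS; apply: GpM]. Qed.

Lemma Gp_Delta : Gp Delta.
Proof. exact: garside_Delta HG. Qed.

Lemma Gp_inv_eq1 x : Gp x -> Gp x^-1 -> x = 1.
Proof. exact: garside_pointed HG _. Qed.

Lemma prefix_of_refl x : le x x.
Proof. by rewrite /prefix_of mulVg; exact: Gp1. Qed.

Lemma prefix_of_trans y x z : le x y -> le y z -> le x z.
Proof. by rewrite /prefix_of => h1 h2; have := GpM h1 h2; group_simp. Qed.

Lemma prefix_of_anti x y : le x y -> le y x -> x = y.
Proof.
move=> h1 h2; have h : (x^-1 * y)^-1 = y^-1 * x by group_simp.
have := Gp_inv_eq1 h1; rewrite h => /(_ h2) e.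
by rewrite -[y](mulVKg x) e mulg1.
Qed.

Lemma le_mul2l z x y : le (z * x) (z * y) <-> le x y.
Proof. by rewrite /prefix_of; group_simp. Qed.

Lemma le_mulr x y : Gp y -> le x (x * y).
Proof. by rewrite /prefix_of mulKg. Qed.

Lemma le1 x : le 1 x <-> Gp x.
Proof. by rewrite /prefix_of invg1 mul1g. Qed.

(** Conjugation by [Delta] takes complements in [Delta] twice, and complements
    of simple elements are simple as left and right divisors of [Delta] agree. *)
Lemma simple_conj s : simple_elements Gp Delta s ->
  simple_elements Gp Delta (s ^ Delta) /\ simple_elements Gp Delta (s ^ Delta^-1).
Proof.
have bal t : simple_elements Gp Delta t <-> Gp t /\ suffix_of Gp t Delta.
  by rewrite (garside_balanced HG).
move=> hs; have [s1 s2] := hs; have [_ s3] := (bal s).1 hs.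
rewrite /prefix_of /suffix_of in s2 s3.
have h1 : simple_elements Gp Delta (s^-1 * Delta).
  by apply/bal; split=> //; rewrite /suffix_of; group_simp.
have h2 : simple_elements Gp Delta (Delta * s^-1).
  by split=> //; rewrite /prefix_of; group_simp.
split.
  apply/bal; split; rewrite /suffix_of conjgE; group_simp => //.
  by have [_] := h1; rewrite /prefix_of; group_simp.
split; rewrite /prefix_of conjgE; group_simp => //.
by have [_] := (bal _).1 h2; rewrite /suffix_of; group_simp.
Qed.

Lemma Gp_conj_Delta x : Gp x -> Gp (x ^ Delta) /\ Gp (x ^ Delta^-1).
Proof.
have : smallest (@is_submonoid G) (simple_elements Gp Delta) `<=`
    [set x | Gp (x ^ Delta) /\ Gp (x ^ Delta^-1)].
  apply: smallest_sub => [|s /simple_conj[[h1 _] [h2 _]]//].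
  split; first by rewrite /= !conj1g; split; exact: Gp1.
  by move=> y z [y1 y2] [z1 z2]; rewrite /= !conjMg; split; apply: GpM.
by rewrite (garside_gen_monoid HG); apply.
Qed.

Lemma Gp_conj_zpow k x : Gp x -> Gp (x ^ D k).
Proof.
case: k => n /=; elim: n x => [|n IH] x hx.
- by rewrite conjg1.
- by rewrite expgSr conjgM; have [] := Gp_conj_Delta (IH _ hx).
- by rewrite expg1; have [] := Gp_conj_Delta hx.
- have -> : Delta ^- n.+2 = Delta ^- n.+1 * Delta^-1.
    by rewrite [Delta ^+ n.+2]expgS invgM.
  by rewrite conjgM; have [] := Gp_conj_Delta (IH _ hx).
Qed.

Lemma le_mul_zpow k x y : le (x * D k) (y * D k) <-> le x y.
Proof.
rewrite /prefix_of.
have e : (x * D k)^-1 * (y * D k) = (x^-1 * y) ^ D k by rewrite conjgE; group_simp.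
rewrite e; split; last exact: Gp_conj_zpow.
by move=> /(Gp_conj_zpow (- k)%R); rewrite zpowN conjgK.
Qed.

Lemma simple_between g : exists i, Gp (g^-1 * D i).
Proof.
pose P := [set g | (exists i, Gp (g^-1 * D i)) /\ (exists j, Gp (D j * g))].
suff /(_ g)[//] : forall x, P x.
have hP : is_subgroup P.
  split; first split.
  - by split; exists 0%R; rewrite zpow0; group_simp; exact: Gp1.
  - move=> x y [[i hi] [j hj]] [[k hk] [l hl]]; split.
      exists (i + k)%R; have := GpM hk (Gp_conj_zpow k hi).
      by rewrite conjgE zpowD; group_simp.
    exists (l + j)%R; have := GpM (Gp_conj_zpow (- l)%R hj) hl.
    by rewrite conjgE zpowD zpowN; group_simp.
  - move=> x [[i hi] [j hj]]; split.
      exists j; have := Gp_conj_zpow j hj; by rewrite conjgE; group_simp.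
    exists i; have := Gp_conj_zpow (- i)%R hi; by rewrite conjgE zpowN; group_simp.
have : smallest (@is_subgroup G) (simple_elements Gp Delta) `<=` P.
  apply: smallest_sub => // s [s1 s2]; split; first by exists 1%R.
  by exists 0%R; rewrite zpow0 mul1g.
by rewrite (garside_gen_group HG) => h x; apply: h.
Qed.

Lemma le_shift_exists x y : exists b, le y (x * D b).
Proof.
have [b hb] := simple_between (x^-1 * y).
by exists b; move: hb; rewrite /prefix_of; group_simp.
Qed.

Lemma le_zpow x a b : (a <= b)%R -> le (x * D a) (x * D b).
Proof.
move=> h; rewrite le_mul2l /prefix_of -zpowN -zpowD.
have -> : (- a + b)%R = ((absz (b - a)%R)%:Z)%R by lia.
exact: GpX Gp_Delta.
Qed.

Hypothesis Delta_neq1 : Delta <> 1.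

Lemma le_zpowE x a b : le (x * D a) (x * D b) <-> (a <= b)%R.
Proof.
split; last exact: le_zpow.
rewrite le_mul2l /prefix_of -zpowN -zpowD => h.
rewrite leNgt; apply/negP => hab; apply: Delta_neq1.
apply: Gp_inv_eq1; first exact: Gp_Delta.
have := GpM h (GpX ((absz (a - b)%R).-1) Gp_Delta).
rewrite -zpow_nat -zpowD.
have -> : (- a + b + (absz (a - b)%R).-1%:Z)%R = (- 1)%R by lia.
by rewrite zpowN.
Qed.

(** The set of such [b] is bounded below since [x] is a prefix of some shift of
    [y] and no negative power of [Delta] lies in [Gp]. *)
Lemma least_shift x y : exists m : int, forall b, le y (x * D b) <-> (m <= b)%R.
Proof.
have [b0 hb0] := le_shift_exists x y.
have [c hc] := le_shift_exists y x.
have lower b : le y (x * D b) -> (- c <= b)%R.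
  move=> /(le_mul_zpow c) h; have := prefix_of_trans hc h.
  rewrite -mulgA -zpowD -{1}[x]mulg1 -(zpow0 Delta) le_zpowE; lia.
have hex : exists n : nat, `[< le y (x * D (n%:Z - c)%R) >].
  exists (absz (b0 + c)%R); apply/asboolP.
  by have -> : ((absz (b0 + c)%R)%:Z - c)%R = b0 by have := lower _ hb0; lia.
case: (ex_minnP hex) => n /asboolP hn hmin.
exists (n%:Z - c)%R => b; split => [hb|hb].
  have eb : b = ((absz (b + c)%R)%:Z - c)%R by have := lower _ hb; lia.
  have := hmin (absz (b + c)%R); rewrite -eb => /(_ (asboolT hb)); lia.
exact: prefix_of_trans hn (le_zpow _ hb).
Qed.

Lemma garside_asymLattice : exists A : asymLattice G,
  [/\ forall x k, shift A x k = x * D k,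
      forall x y (b : int), (adist A x y <= b)%R <-> le y (x * D b) &
      forall z x y, adist A (z * x) (z * y) = adist A x y].
Proof.
have /choice[F hF'] : forall x, exists f : G -> int, forall y (b : int),
    (f y <= b)%R <-> le y (x * D b).
  move=> x; have /choice[f hf] := least_shift x.
  by exists f => y b; rewrite (hf y).
have [_ _ _ hmeet hjoin] := garside_prefix_lattice HG.
have /choice[mt hmt] : forall x, exists f : G -> G, forall y,
    [/\ le (f y) x, le (f y) y & forall z, le z x -> le z y -> le z (f y)].
  by move=> x; have /choice[f hf] := hmeet x; exists f.
have /choice[jn hjn] : forall x, exists f : G -> G, forall y,
    [/\ le x (f y), le y (f y) & forall z, le x z -> le y z -> le (f y) z].
  by move=> x; have /choice[f hf] := hjoin x; exists f.
have eqF (a c : int) : (forall b : int, (a <= b)%R <-> (c <= b)%R) -> a = c.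
  by move=> h; apply/eqP; rewrite eq_le (h c).2 ?(h a).1.
have F_self x : F x x = 0%R.
  apply: eqF => b; rewrite hF' -{1}[x]mulg1 -(zpow0 Delta) le_zpowE; lia.
have F_tri y x z : (F x z <= F x y + F y z)%R.
  rewrite hF' zpowD mulgA; apply: (@prefix_of_trans (y * D (F y z))).
    by rewrite -hF'.
  by rewrite le_mul_zpow -hF'.
have F_shl x k y : F (x * D k) y = (F x y - k)%R.
  apply: eqF => b; rewrite hF' -mulgA -zpowD -hF'; lia.
have F_shr x y k : F x (y * D k) = (F x y + k)%R.
  apply: eqF => b; rewrite hF'.
  have -> : x * D b = x * D (b - k)%R * D k.
    by rewrite -mulgA -zpowD; congr (_ * D _); lia.
  by rewrite le_mul_zpow -hF'; lia.
have F_mt x y z : F (mt x y) z = Num.max (F x z) (F y z).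
  have [m1 m2 m3] := hmt x y.
  apply: eqF => b; rewrite hF' ge_max; split.
    move=> h; apply/andP; split; apply/hF'; apply: prefix_of_trans h _;
    by rewrite le_mul_zpow.
  move=> /andP[/hF' h1 /hF' h2].
  have h3 u : le z (u * D b) -> le (z * D (- b)%R) u.
    by move=> h; rewrite -(le_mul_zpow b) -mulgA -zpowD addNr mulg1.
  rewrite -(le_mul_zpow (- b)%R) -[X in le _ X]mulgA -zpowD addrN mulg1.
  by apply: m3; apply: h3.
have F_jn x y z : F z (jn x y) = Num.max (F z x) (F z y).
  have [m1 m2 m3] := hjn x y.
  apply: eqF => b; rewrite hF' ge_max; split.
    move=> h; apply/andP.
    by split; apply/hF'; [exact: prefix_of_trans m1 h|exact: prefix_of_trans m2 h].
  by move=> /andP[/hF' h1 /hF' h2]; apply: m3.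
exists (@AsymLattice G F (fun x k => x * D k) mt jn
  F_self F_tri F_shl F_shr F_mt F_jn); split => //= z x y.
by apply: eqF => b; rewrite !hF' -mulgA le_mul2l.
Qed.

End GarsideBasics.

Section FiniteType.
Context (G : groupType) (Gp : set G) (Delta : G).
Hypothesis HG : garside_structure Gp Delta.
Hypothesis Hfin : finite_type Gp Delta.

(** Conjugation by [Delta] permutes the finite set of generators. *)
Lemma Delta_power_central : exists e : nat, (0 < e)%N /\
  forall x, x * Delta ^+ e = Delta ^+ e * x.
Proof.
have [l hl] := (finite_seqP _).1 Hfin.
have per s : exists n : nat, simple_elements Gp Delta s ->
    (0 < n)%N /\ s ^ (Delta ^+ n) = s.
  have [hs|hs] := pselect (simple_elements Gp Delta s); last by exists 0%N.
  have hin n : s ^ (Delta ^+ n) \in l.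
    have : simple_elements Gp Delta (s ^ (Delta ^+ n)).
      elim: n => [|n IH]; first by rewrite conjg1.
      by rewrite expgSr conjgM; have [] := simple_conj HG IH.
    by rewrite hl.
  have [i [j [hij e]]] := pigeonhole_seq hin.
  exists (j - i)%N => _; split; first by rewrite subn_gt0.
  apply: (conjg_inj (Delta ^+ i)); rewrite -conjgM -expgnDr subnK ?e //.
  exact: ltnW.
have [n hn] := choice per.
exists (\prod_(s <- l) (if n s == 0 then 1 else n s))%N; split.
  apply: (big_ind (fun m => 0 < m)%N) => // [x y x0 y0|s _].
    by rewrite muln_gt0 x0.
  by case: ifP => // /negbT; rewrite lt0n.
set e := (\prod_(s <- l) _)%N.
have fixs s : simple_elements Gp Delta s -> s ^ (Delta ^+ e) = s.
  move=> hs; have [n0 hns] := hn s hs.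
  have sl : s \in l by move: hs; rewrite hl.
  have [q ->] : exists q, e = (n s * q)%N.
    rewrite /e (big_rem s) //=; case: ifP => [/eqP e0|_]; first by rewrite e0 in n0.
    by eexists.
  elim: q => [|q IH]; first by rewrite muln0 conjg1.
  by rewrite mulnS expgnDr conjgM hns.
suff h : forall x, x ^ (Delta ^+ e) = x.
  by move=> x; rewrite -{2}(h x) conjgE mulVKg.
have : smallest (@is_subgroup G) (simple_elements Gp Delta) `<=`
    [set x | x ^ (Delta ^+ e) = x].
  apply: smallest_sub => //; split; first split; first by rewrite /= conj1g.
    by move=> x y /= hx hy; rewrite conjMg hx hy.
  by move=> x /= hx; rewrite conjVg hx.
by rewrite (garside_gen_group HG) => h x; apply: h.
Qed.

End FiniteType.

(** * The center of an indecomposable Garside group *)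
Section Center.
Context (G : groupType) (Gp : set G) (Delta : G).
Hypothesis HG : garside_structure Gp Delta.
Hypothesis Hfin : finite_type Gp Delta.
Local Notation le := (prefix_of Gp).
Local Notation D := (zpow Delta).

Definition left_coprime (x y : G) := forall z, Gp z -> le z x -> le z y -> z = 1.

(** These are the quasi-central elements: normalizing elements commute with the
    monoid [Gp] as a set. *)
Definition normalizing (x : G) := forall y, Gp (y ^ x) <-> Gp y.

Lemma join_exists x y : exists j, [/\ le x j, le y j &
  forall z, le x z -> le y z -> le j z].
Proof. by have [_ _ _ _ h] := garside_prefix_lattice HG; apply: h. Qed.

Lemma meet_exists x y : exists m, [/\ le m x, le m y &
  forall z, le z x -> le z y -> le z m].
Proof. by have [_ _ _ h _] := garside_prefix_lattice HG; apply: h. Qed.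

Lemma le_mulgE x y : le x y -> exists2 z, Gp z & y = x * z.
Proof. by move=> h; exists (x^-1 * y) => //; rewrite mulVKg. Qed.

Lemma coprime_sym x y : left_coprime x y -> left_coprime y x.
Proof. by move=> h z h1 h2 h3; apply: h. Qed.

Lemma Gp_below x y : Gp x -> le x y -> Gp y.
Proof. by move=> hx /le_mulgE[z hz ->]; exact: (GpM HG hx hz). Qed.

(** Induction on [n]: removing the meet with [Delta] from a prefix of
    [Delta ^+ n.+1] leaves a prefix of [Delta ^+ n]. *)
Lemma prefixes_of_Delta_power n :
  exists l : seq G, forall x, Gp x -> le x (Delta ^+ n) -> x \in l.
Proof.
have [ls hls] := (finite_seqP _).1 Hfin.
elim: n => [|n [l hl]].
  exists [:: 1] => x hx hx1; rewrite inE; apply/eqP.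
  rewrite expg0 in hx1.
  have h1x : le 1 x by apply/le1.
  exact: (prefix_of_anti HG hx1 h1x).
exists [seq s * x | s <- ls, x <- l] => b hb hle.
have [s [s1 s2 s3]] := meet_exists b Delta.
have hs : Gp s by apply/le1; apply: s3; apply/le1 => //; exact: Gp_Delta HG.
rewrite -(mulVKg s b); apply: allpairs_f.
  have : simple_elements Gp Delta s by [].
  by rewrite hls.
apply: hl => //.
have : le (b * D (- n%:Z)%R) s.
  apply: s3.
    by rewrite -{2}[b]mulg1 -(zpow0 Delta); apply: (le_zpow HG); lia.
  have e : Delta ^+ n.+1 * D (- n%:Z)%R = Delta by rewrite expgS zpowN /= mulgK.
  by rewrite -[X in le _ X]e; apply/(le_mul_zpow HG).
move=> /(le_mul_zpow HG n%:Z).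
rewrite -mulgA -zpowD addNr zpow0 mulg1 /=.
by rewrite -{1}[b](mulVKg s) le_mul2l.
Qed.

Lemma le_Delta_power x : exists n, le x (Delta ^+ n).
Proof.
have [b hb] := le_shift_exists HG 1 x.
exists `|b|%N; rewrite mul1g in hb; apply: (prefix_of_trans HG hb).
have := le_zpow HG 1 (_ : (b <= `|b|%N%:Z)%R); rewrite !mul1g; apply; lia.
Qed.

Lemma finite_prefixes z : exists l : seq G, forall x, Gp x -> le x z -> x \in l.
Proof.
have [n hn] := le_Delta_power z; have [l hl] := prefixes_of_Delta_power n.
by exists l => x hx hxz; apply: hl => //; apply: (prefix_of_trans HG hxz hn).
Qed.

Lemma count_prefixes_lt (l : seq G) x y : Gp y -> y \in l -> le x y -> y <> x ->
  (count (fun u => `[< Gp u /\ le u x >]) l <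
   count (fun u => `[< Gp u /\ le u y >]) l)%N.
Proof.
move=> gy yl hxy hne.
set a := fun u => `[< Gp u /\ le u x >]; set b := fun u => `[< Gp u /\ le u y >].
have ab u : a u -> b u.
  move=> /asboolP[h1 h2]; apply/asboolP; split=> //; exact: (prefix_of_trans HG h2 hxy).
have ay : a y = false.
  by apply/asboolP => -[_ h]; apply: hne; apply: (prefix_of_anti HG h hxy).
have bY : b y by apply/asboolP; split => //; exact: prefix_of_refl HG y.
have y1 : (0 < count (pred1 y) l)%N by rewrite -has_count has_pred1.
have UI := count_predUI a (pred1 y) l.
have hU : (count (predU a (pred1 y)) l <= count b l)%N.
  by apply: sub_count => u /orP[/ab|/eqP ->].
have hI : count (predI a (pred1 y)) l = 0%N.
  by apply/eqP; rewrite -leqn0 leqNgt -has_count; apply/hasPn => u _ /=;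
    apply/negP => /andP[h /eqP e]; move: h; rewrite e ay.
rewrite hI addn0 in UI; rewrite UI in hU; apply: leq_trans hU.
by rewrite -addn1 leq_add2l.
Qed.

Lemma exists_maximal_prefix (P : G -> Prop) z x0 : P x0 ->
  (forall x, P x -> Gp x /\ le x z) ->
  exists2 x, P x & forall y, P y -> le x y -> y = x.
Proof.
move=> h0 hP; have [l hl] := finite_prefixes z.
pose below x := count (fun u => `[< Gp u /\ le u x >]) l.
have hex : exists n, `[< exists2 x, P x & below x = n >].
  by exists (below x0); apply/asboolP; exists x0.
have hub n : `[< exists2 x, P x & below x = n >] -> (n <= size l)%N.
  by move=> /asboolP[x _ <-]; apply: count_size.
case: (ex_maxnP hex hub) => n /asboolP[x hx hn] hmax.
exists x => // y hy hxy; apply: contrapT => hne.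
have hy' : `[< exists2 x, P x & below x = below y >] by apply/asboolP; exists y.
have [gy ly] := hP _ hy.
have := hmax _ hy'; rewrite -hn leqNgt => /negP; apply.
by apply: count_prefixes_lt => //; apply: hl.
Qed.

Lemma exists_minimal_prefix (P : G -> Prop) z x0 : P x0 ->
  (forall x, P x -> Gp x /\ le x z) ->
  exists2 x, P x & forall y, P y -> le y x -> y = x.
Proof.
move=> h0 hP; have [l hl] := finite_prefixes z.
pose below x := count (fun u => `[< Gp u /\ le u x >]) l.
have hex : exists n, `[< exists2 x, P x & below x = n >].
  by exists (below x0); apply/asboolP; exists x0.
case: (ex_minnP hex) => n /asboolP[x hx hn] hmin.
exists x => // y hy hyx; apply: contrapT => hne.
have hy' : `[< exists2 x, P x & below x = below y >] by apply/asboolP; exists y.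
have [gx lx] := hP _ hx.
have := hmin _ hy'; rewrite -hn leqNgt => /negP; apply.
by apply: count_prefixes_lt => //; [apply: hl|exact/nesym].
Qed.

Lemma le_conj p x y : normalizing p -> le x y -> le (x ^ p) (y ^ p).
Proof. by move=> hp h; rewrite /prefix_of -conjVg -conjMg; apply/hp. Qed.

Lemma normalizing_mul p q : normalizing p -> normalizing q -> normalizing (p * q).
Proof. by move=> hp hq y; rewrite conjgM hq hp. Qed.

Lemma normalizing_inv p : normalizing p -> normalizing p^-1.
Proof. by move=> hp y; rewrite -{2}(conjgKV p y) hp. Qed.

Lemma normalizing_pow p n : normalizing p -> normalizing (p ^+ n).
Proof.
move=> hp; elim: n => [|n IH]; first by move=> y; rewrite conjg1.
by rewrite expgS; apply: normalizing_mul.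
Qed.

Lemma le_mulr_normalizing p x y : normalizing p -> le x y -> le (x * p) (y * p).
Proof.
move=> hp h; rewrite /prefix_of.
have -> : (x * p)^-1 * (y * p) = (x^-1 * y) ^ p by rewrite conjgE; group_simp.
exact/hp.
Qed.

Lemma le_mull_normalizing p b : normalizing p -> Gp b -> le p (b * p).
Proof. by move=> hp hb; rewrite /prefix_of -conjgE; apply/hp. Qed.

(** Left and right divisors of a normalizing element agree, because
    [p = x * y] gives [y^-1 * p = x ^ p]. *)
Lemma normalizing_suffix p x y : normalizing p -> p = x * y -> Gp x -> le y p.
Proof.
move=> hp e hx; rewrite /prefix_of.
have -> : y^-1 * p = x ^ p by rewrite conjgE {2}e; group_simp.
exact/hp.
Qed.

Lemma normalizing_prefix p y : normalizing p -> le y p ->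
  exists2 x, Gp x & p = x * y.
Proof.
move=> hp hy; exists (p * y^-1); last by group_simp.
have -> : p * y^-1 = (y^-1 * p) ^ p^-1 by rewrite conjgE; group_simp.
exact/normalizing_inv.
Qed.

Section CoprimePair.
Context (p r : G).
Hypotheses (np : normalizing p) (nr : normalizing r) (gp : Gp p) (gr : Gp r).
Hypotheses (pr : left_coprime p r) (comm : p * r = r * p).

(** Write [p * r] as the join of [p] and [r] times [c1].  Then [c1] is a right
    divisor, hence a left divisor, of both [p] and [r], so it is trivial. *)
Lemma coprime_join j : le p j -> le r j -> le (p * r) j.
Proof.
have [j0 [h1 h2 h3]] := join_exists r p; move=> hp hr.
suff -> : p * r = j0 by apply: h3.
have /le_mulgE[c1 gc1 e1] : le j0 (p * r).
  by apply: h3; [rewrite comm; apply: le_mulr|apply: le_mulr].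
have /le_mulgE[c0 gc0 e0] := h2; have /le_mulgE[d0 gd0 f0] := h1.
have er : r = c0 * c1 by apply: (mulgI p); rewrite e1 e0 mulgA.
have ep : p = d0 * c1 by apply: (mulgI r); rewrite -comm e1 f0 mulgA.
have c11 : c1 = 1.
  by apply: pr => //; [apply: normalizing_suffix ep gd0|apply: normalizing_suffix er gc0].
by rewrite e1 c11 mulg1.
Qed.

(** Complete [y] to [p = y0 * y]; after multiplication by [y0] on the left, the
    claim follows from [coprime_join]. *)
Lemma divisor_join y j : Gp y -> le y p -> le r j -> le y j -> le (y * r) j.
Proof.
move=> gy hy hr hyj.
have [y0 gy0 ey] := normalizing_prefix np hy.
rewrite -(le_mul2l Gp y0) mulgA -ey.
apply: coprime_join; first by rewrite ey; apply/le_mul2l.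
apply: (prefix_of_trans HG (le_mull_normalizing nr gy0)).
exact/le_mul2l.
Qed.

(** The map [y |-> c^-1 * join c y] sends prefixes of [p] to prefixes of [p].  It
    is injective, since joining further with [r] recovers [y * r] by
    [divisor_join]; as [p] has finitely many prefixes it is surjective. *)
Lemma residual_surjective c d : Gp c -> le c r -> Gp d -> le d p ->
  exists y, [/\ Gp y, le y p, le y (c * d) &
    forall z, le c z -> le y z -> le (c * d) z].
Proof.
move=> gc hcr gd hdp.
have res y : exists z, Gp y -> le y p -> [/\ Gp z, le z p, le y (c * z) &
    forall u, le c u -> le y u -> le (c * z) u].
  have [[gy hy]|hn] := pselect (Gp y /\ le y p); last first.
    by exists 1 => gy hy; case: hn.
  have [j [h1 h2 h3]] := join_exists c y.
  have [z gz ez] := le_mulgE h1; exists z => _ _; rewrite -ez; split => //.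
  apply/(le_mul2l Gp c); rewrite -ez; apply: h3; first exact: le_mulr.
  exact: (prefix_of_trans HG hy (le_mull_normalizing np gc)).
have [f hf] := choice res.
have f_inj y y' : Gp y -> le y p -> Gp y' -> le y' p -> f y = f y' -> y = y'.
  have key u u' : Gp u -> le u p -> Gp u' -> le u' p -> f u = f u' ->
      le (u' * r) (u * r).
    move=> gu hu gu' hu' e.
    have [_ _ h1 h2] := hf u gu hu; have [_ _ h3 h4] := hf u' gu' hu'.
    apply: divisor_join => //; first exact: le_mull_normalizing.
    apply: (prefix_of_trans HG h3); rewrite -e; apply: h2; last exact: le_mulr.
    exact: (prefix_of_trans HG hcr (le_mull_normalizing nr gu)).
  by move=> gy hy gy' hy' e; apply: (mulIg r); apply: (prefix_of_anti HG); apply: key.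
have fP y : Gp y /\ le y p -> Gp (f y) /\ le (f y) p.
  by move=> [gy hy]; have [] := hf y gy hy.
have itP n : Gp (iter n f d) /\ le (iter n f d) p.
  by elim: n => //= n; apply: fP.
have [l hl] := finite_prefixes p.
have [i [j [hij e]]] := @pigeonhole_seq _ l (fun n => iter n f d)
  (fun n => hl _ (itP n).1 (itP n).2).
have {}e : iter (j - i) f d = d.
  elim: i j hij e => [|i IH] [|j] // hij /= e.
  rewrite subSS; apply: IH => //.
  by apply: f_inj e; have [] := itP i; have [] := itP j.
have ej : (j - i = (j - i.+1).+1)%N by rewrite subnSK.
rewrite ej /= in e.
have [g1 g2] := itP (j - i.+1)%N; have [h1 h2 h3 h4] := hf _ g1 g2.
by exists (iter (j - i.+1) f d); rewrite e in h3 h4.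
Qed.

(** From the join of [b] and [p] one gets [b = c' * d'] with [c'] a prefix of [r]
    and [d'] a prefix of [p].  If [d'] were nontrivial, [residual_surjective]
    would turn it into a nontrivial common prefix of [b] and [p]. *)
Lemma coprime_factor b : Gp b -> left_coprime b p -> le b (p * r) -> le b r.
Proof.
move=> gb hbp hle.
have [j [h1 h2 h3]] := join_exists b p.
have [d gd ed] := le_mulgE h1; have [c gc ec] := le_mulgE h2.
have hc : le c r.
  by apply/(le_mul2l Gp p); rewrite -ec; apply: h3 => //; apply: le_mulr.
have hd : le d p.
  apply/(le_mul2l Gp b); rewrite -ed; apply: h3; first exact: le_mulr.
  exact: le_mull_normalizing.
have [d' gd' ed'] := normalizing_prefix np hd.
have hd' : le d' p by rewrite ed'; apply: le_mulr.
pose c' := c ^ p^-1.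
have gc' : Gp c' by apply/normalizing_inv.
have hc' : le c' r.
  have -> : r = r ^ p^-1 by rewrite conjgE invgK mulgA comm mulgK.
  by apply: le_conj hc; apply: normalizing_inv.
have eb : b = c' * d'.
  by apply: (mulIg d); rewrite -mulgA -ed' -ed ec /c' conjgE; group_simp.
have [y [gy hy hyb hmin]] := residual_surjective gc' hc' gd' hd'.
have y1 : y = 1 by apply: hbp => //; rewrite eb.
have : le (c' * d') c'.
  by apply: hmin; [exact: prefix_of_refl HG c'|rewrite y1; apply/le1].
rewrite -eb => h; exact: (prefix_of_trans HG h hc').
Qed.

End CoprimePair.

Lemma coprime_prefix_pow p x n : normalizing p -> Gp p -> left_coprime p x -> Gp x ->
  le x (p ^+ n) -> x = 1.
Proof.
move=> np gp hpx gx; elim: n => [|n IH] hle.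
  by rewrite expg0 in hle; apply: (prefix_of_anti HG hle); apply/le1.
apply: IH.
have npn := normalizing_pow n np.
have [m [m1 m2 m3]] := meet_exists (p ^+ n.+1) (p ^+ n * x ^ (p ^+ n)).
have hxm : le x m.
  by apply: m3 => //; rewrite -conjgC; apply: le_mulr; apply: (GpX HG).
suff <- : m = p ^+ n by [].
pose q := (p ^+ n)^-1 * m.
have hq : le (p ^+ n) m.
  apply: m3; first by rewrite expgSr; apply: le_mulr.
  by apply: le_mulr; apply/npn.
have nnp := normalizing_inv npn.
have q1 : q ^ (p ^+ n)^-1 = 1.
  apply: hpx; first by apply/nnp.
    have e : p ^ (p ^+ n)^-1 = p by rewrite conjgE invgK mulgA -expgSr expgS mulgK.
    rewrite -[X in le _ X]e; apply: le_conj => //.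
    by apply/(le_mul2l Gp (p ^+ n)); rewrite mulVKg -expgSr.
  rewrite -[x in le _ x](conjgK (p ^+ n)).
  by apply: le_conj => //; apply/(le_mul2l Gp (p ^+ n)); rewrite mulVKg.
by rewrite -[m](mulVKg (p ^+ n)) -/q -[q](conjgKV (p ^+ n)) q1 conj1g mulg1.
Qed.

Lemma coprime_pow p r n k : normalizing p -> normalizing r -> Gp p -> Gp r ->
  left_coprime p r -> left_coprime (p ^+ n) (r ^+ k).
Proof.
move=> np nr gp gr hpr x gx hxp hxr.
apply: (coprime_prefix_pow (p := p) (n := n)) => // y gy hyp hyx.
apply: (coprime_prefix_pow (p := r) (n := k)) => //; last exact: (prefix_of_trans HG hyx).
by move=> z gz hzr hzy; apply: hpr => //; exact: (prefix_of_trans HG hzy).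
Qed.

Definition power_prefixes (p : G) : set G :=
  [set x | Gp x /\ exists n, le x (p ^+ n)].

Lemma power_prefixes_submonoid p : normalizing p ->
  is_submonoid (power_prefixes p).
Proof.
move=> np; split; first by split; [exact: (Gp1 HG)|exists 0%N; exact: prefix_of_refl HG 1].
move=> x y [gx [n hx]] [gy [k hy]]; split; first exact: (GpM HG).
exists (n + k)%N; rewrite expgnDr.
apply: (prefix_of_trans HG (y := x * p ^+ k)); first exact/le_mul2l.
by apply: le_mulr_normalizing hx; apply: normalizing_pow.
Qed.

Lemma le_pow p n k : Gp p -> (n <= k)%N -> le (p ^+ n) (p ^+ k).
Proof.
by move=> gp h; rewrite -(subnKC h) expgnDr; apply: le_mulr; apply: (GpX HG).
Qed.

(** The factor in [power_prefixes p] is the largest prefix of [m] in this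
    submonoid; what remains is coprime to [p], hence divides a power of [r] by
    [coprime_factor].  It is unique because an element of [power_prefixes p] that
    is a prefix of [a1 * b1] is already a prefix of [a1]. *)
Lemma unique_factorization p r m : normalizing p -> normalizing r ->
  Gp p -> Gp r -> left_coprime p r -> p * r = r * p ->
  (forall x, Gp x -> exists n k, le x (p ^+ n * r ^+ k)) -> Gp m ->
  exists! u : G * G, [/\ power_prefixes p u.1, power_prefixes r u.2 & m = u.1 * u.2].
Proof.
move=> np nr gp gr hpr comm hall gm.
have [Ap1 ApM] := power_prefixes_submonoid np.
pose P a := power_prefixes p a /\ le a m.
have [||a [[ga [n ha]] ham] amax] := @exists_maximal_prefix P m 1.
- by split => //; apply/le1.
- by move=> x [[gx _] hx].
have [b gb eb] := le_mulgE ham.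
have hbp : left_coprime p b.
  move=> x gx hxp hxb; apply: (mulgI a); rewrite mulg1; apply: amax.
    split; last by rewrite eb; apply/le_mul2l.
    by apply: ApM; split => //; [exists n|exists 1%N].
  exact: le_mulr.
have [N [K hb]] := hall b gb.
have pr_pow : p ^+ N * r ^+ K = r ^+ K * p ^+ N by apply: commuteX2.
have hbr : le b (r ^+ K).
  apply: (coprime_factor (p := p ^+ N)) => //.
  - exact: normalizing_pow.
  - exact: normalizing_pow.
  - exact: (GpX HG).
  - exact: (GpX HG).
  - exact: coprime_pow.
  move=> x gx hxb hxp; apply: (coprime_prefix_pow (p := p) (n := N)) => //.
  by move=> y gy hyp hyx; apply: hbp => //; exact: (prefix_of_trans HG hyx).
have below a1 b1 x : power_prefixes p a1 -> power_prefixes r b1 ->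
    power_prefixes p x -> le x (a1 * b1) -> le x a1.
  move=> [ga1 [n1 ha1]] [gb1 [k1 hb1]] [gx [n2 hx]] hle.
  have [j [h1 h2 h3]] := join_exists a1 x.
  have [y gy ey] := le_mulgE h1.
  have hyb : le y b1.
    by apply/(le_mul2l Gp a1); rewrite -ey; apply: h3 => //; apply: le_mulr.
  have hj : le j (p ^+ (n1 + n2)).
    by apply: h3; [apply: (prefix_of_trans HG ha1)|apply: (prefix_of_trans HG hx)];
      apply: le_pow; rewrite ?leq_addr ?leq_addl.
  have [t gt et] := le_mulgE hj.
  have hyt : le y (p ^+ (n1 + n2)).
    apply: (prefix_of_trans HG (y := y * t)); first exact: le_mulr.
    apply: (normalizing_suffix (x := a1)) => //; first exact: normalizing_pow.
    by rewrite et ey mulgA.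
  suff y1 : y = 1 by rewrite -[a1]mulg1 -y1 -ey.
  apply: (coprime_pow (n := n1 + n2) (k := k1) np nr gp gr hpr) => //.
  exact: (prefix_of_trans HG hyb).
exists (a, b); split; first by split => //=; split => //; [exists n|exists K].
move=> [a' b'] /= [Aa' Bb' em].
have ea : a = a'.
  apply: (prefix_of_anti HG).
    by apply: (below a' b') => //; [split => //; exists n|rewrite -em].
  apply: (below a b) => //; [by split => //; exists n|by split => //; exists K|].
  by rewrite -eb em; have [ga' _] := Aa'; apply: le_mulr; have [] := Bb'.
by congr (_, _) => //; apply: (mulgI a); rewrite -eb em ea.
Qed.

Lemma normalizing_central z : (forall x, x * z = z * x) -> normalizing z.
Proof. by move=> hz y; rewrite conjgE hz mulKg. Qed.

(** Conjugation by the meet maps [Gp] into itself because [b * p] and [b * q] are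
    multiples of [p] and [q].  Since it permutes the finitely many prefixes of a
    central power of [Delta], it is onto. *)
Lemma normalizing_meet p q m : normalizing p -> normalizing q ->
  Gp p -> Gp q -> le m p -> le m q ->
  (forall z, le z p -> le z q -> le z m) -> normalizing m.
Proof.
move=> np nq gp gq mp mq mglb.
have conj1 b : Gp b -> Gp (b ^ m).
  move=> gb; rewrite conjgE -/(prefix_of Gp m (b * m)).
  have h u : le m u -> normalizing u -> le (b^-1 * m) u.
    move=> h nu; apply/(le_mul2l Gp b); rewrite mulVKg.
    exact: (prefix_of_trans HG h (le_mull_normalizing nu gb)).
  have [j [h1 h2 h3]] := meet_exists (b * p) (b * q).
  have hj : le j (b * m).
    rewrite -(mulVKg b j); apply/le_mul2l; apply: mglb;
    by apply/(le_mul2l Gp b); rewrite mulVKg.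
  apply: (prefix_of_trans HG _ hj); apply: h3.
    exact: (prefix_of_trans HG mp (le_mull_normalizing np gb)).
  exact: (prefix_of_trans HG mq (le_mull_normalizing nq gb)).
have [e [e0 he]] := Delta_power_central HG Hfin.
have simple_inv s : simple_elements Gp Delta s -> Gp (s ^ m^-1).
  move=> [gs hs].
  have [l hl] := finite_prefixes (Delta ^+ e).
  have hin n : Gp (s ^ (m ^+ n)) /\ le (s ^ (m ^+ n)) (Delta ^+ e).
    elim: n => [|n [g1 g2]].
      rewrite conjg1; split => //; apply: (prefix_of_trans HG hs).
      exact: (@le_pow Delta 1 e (Gp_Delta HG) e0).
    rewrite expgSr conjgM; split; first exact: conj1.
    have -> : Delta ^+ e = (Delta ^+ e) ^ m by rewrite conjgE -he mulKg.
    by rewrite /prefix_of -conjVg -conjMg; apply: conj1.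
  have [i [j [hij eij]]] := @pigeonhole_seq _ l (fun n => s ^ (m ^+ n))
    (fun n => hl _ (hin n).1 (hin n).2).
  have : s ^ m^-1 = s ^ (m ^+ (j - i.+1)).
    apply: (conjg_inj (m ^+ i.+1)); rewrite -!conjgM expgS mulKg -expgS -expgnDr.
    by rewrite subnK.
  by move=> ->; have [] := hin (j - i.+1)%N.
have conj2 : smallest (@is_submonoid G) (simple_elements Gp Delta) `<=`
    [set x | Gp (x ^ m^-1)].
  apply: smallest_sub => //; split; first by rewrite /= conj1g; exact: (Gp1 HG).
  by move=> x y /= hx hy; rewrite conjMg; apply: (GpM HG).
rewrite (garside_gen_monoid HG) in conj2.
by move=> y; split => [/conj2|/conj1//]; rewrite /= conjgK.
Qed.

Hypothesis Hpure : Delta_pure Gp.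
Hypothesis Delta_neq1 : Delta <> 1.

Lemma extract_power p z : Gp p -> p <> 1 -> Gp z ->
  exists k y, [/\ z = p ^+ k * y, Gp y & ~ le p y].
Proof.
move=> gp p1 gz.
pose P x := exists2 k, x = p ^+ k & le x z.
have [||x [k ek hk] kmax] := @exists_maximal_prefix P z 1.
- by exists 0%N => //; apply/le1.
- by move=> x [k -> hk]; split => //; apply: (GpX HG).
have [y gy ey] := le_mulgE hk; exists k, y; split; rewrite -?ek // => hpy.
apply: p1; apply: (mulgI x); rewrite mulg1; apply: kmax; last exact: le_mulr.
exists k.+1; first by rewrite ek expgSr.
by rewrite ey; apply/le_mul2l.
Qed.

(** Let [p] be a minimal nontrivial normalizing prefix of a central power [E] of
    [Delta].  Meets with [p] of normalizing elements are trivial or equal to [p],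
    so [E = p ^+ k * r] with [r] coprime to [p].  If [r] were nontrivial, the
    prefixes of powers of [p] and those of powers of [r] would decompose [Gp].
    Hence [E] is a power of [p].  The same argument writes a central element of
    [Gp] as [p ^+ q * s] with [s] coprime to [p]; as [s] divides a power of [E],
    it is trivial.  So the center consists of powers of [p]. *)
Lemma center_finite_mod_Delta : exists l : seq G, forall z, center z ->
  exists2 y, y \in l & exists m, z = y * D m.
Proof.
have [e [e0 he]] := Delta_power_central HG Hfin.
pose E := Delta ^+ e; rewrite -/E in he.
have nE : normalizing E by apply: normalizing_central.
have gE : Gp E by apply: (GpX HG); exact: Gp_Delta HG.
have E1 : E <> 1.
  move=> E1; apply: Delta_neq1; apply: (Gp_inv_eq1 HG (Gp_Delta HG)).
  have -> : Delta^-1 = Delta ^+ e.-1.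
    apply: (mulgI Delta); rewrite mulgV -expgS prednK //.
  by apply: (GpX HG); exact: Gp_Delta HG.
pose P x := [/\ Gp x, normalizing x, x <> 1 & le x E].
have [||p [gp np p1 hpE] pmin] := @exists_minimal_prefix P E E.
- by split => //; exact: prefix_of_refl HG E.
- by move=> x [].
have split_central z : Gp z -> (forall x, x * z = z * x) ->
    exists k r, [/\ z = p ^+ k * r, Gp r, normalizing r, left_coprime p r & p * r = r * p].
  move=> gz hz; have [k [r [ez gr hpr]]] := extract_power gp p1 gz.
  have nr : normalizing r.
    have -> : r = (p ^+ k)^-1 * z by rewrite ez mulKg.
    apply: normalizing_mul; last exact: normalizing_central.
    exact/normalizing_inv/normalizing_pow.
  exists k, r; split => //.
    have [m [m1 m2 m3]] := meet_exists p r.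
    have gm : Gp m by apply/le1/m3; apply/le1.
    have [m1'|hm1] := pselect (m = 1).
      move=> x gx hxp hxr; apply: (prefix_of_anti HG); last exact/le1.
      by rewrite -m1'; apply: m3.
    have : m = p.
      apply: pmin => //; split => //; last exact: (prefix_of_trans HG m1).
      exact: normalizing_meet m1 m2 m3.
    by move=> emp; rewrite emp in m2.
  apply: (mulgI (p ^+ k)); rewrite [RHS]mulgA -ez mulgA -expgSr expgS -mulgA -ez.
  exact: hz.
have [k [r [eE gr nr hpr comm]]] := split_central E gE he.
have [r1|r1] := pselect (r = 1); last first.
  exfalso; apply: Hpure; exists (power_prefixes p), (power_prefixes r).
  have hall x : Gp x -> exists n k, le x (p ^+ n * r ^+ k).
    move=> gx; have [n hn] := le_Delta_power x.
    exists (k * n)%N, n; rewrite expgnA -expgMn; last exact/commute_sym/commuteX.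
    rewrite -eE /E -expgnA; apply: (prefix_of_trans HG hn); apply: le_pow.
      exact: Gp_Delta HG.
    by rewrite leq_pmull.
  split.
  - by split; apply: power_prefixes_submonoid.
  - by split => x [].
  - have self x : Gp x -> power_prefixes x x.
      by move=> gx; split => //; exists 1%N; exact: prefix_of_refl HG x.
    by split=> e1; [apply: p1; have := self p gp|apply: r1; have := self r gr];
      rewrite e1.
  - move=> m gm; split; first exact: unique_factorization.
    apply: unique_factorization => //; first exact: coprime_sym.
    move=> x gx; have [n [j hx]] := hall x gx; exists j, n.
    have -> : r ^+ j * p ^+ n = p ^+ n * r ^+ j by apply: commuteX2.
    by [].
rewrite r1 mulg1 in eE.
have k0 : (0 < k)%N by rewrite lt0n; apply/eqP => k0; apply: E1; rewrite eE k0.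
exists [seq p ^+ i | i <- iota 0 k] => z hz.
have [i hi] := simple_between HG z^-1; rewrite invgK in hi.
have cE n x : x * E ^+ n = E ^+ n * x by apply: commuteX; apply: he.
have hN : Gp (z * E ^+ `|i|%N).
  have h := le_zpow HG z (_ : (i <= (e * `|i|)%N%:Z)%R).
  have : Gp (z * D (e * `|i|)%N%:Z).
    apply: (Gp_below hi); apply: h.
    by have := leq_pmull `|i|%N e0; lia.
  by rewrite zpow_nat expgnA.
have cz : forall x, x * (z * E ^+ `|i|%N) = z * E ^+ `|i|%N * x.
  by move=> x; rewrite mulgA -hz -!mulgA cE.
have [q [s [ez gs ns hps comms]]] := split_central _ hN cz.
have s1 : s = 1.
  have [n hn] := le_Delta_power (z * E ^+ `|i|%N).
  apply: (coprime_prefix_pow (p := p) (n := (k * n)%N)) => //.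
  rewrite expgnA -eE.
  apply: (prefix_of_trans HG (y := Delta ^+ n)); last first.
    by rewrite /E -expgnA; apply: le_pow; [exact: Gp_Delta HG|rewrite leq_pmull].
  apply: (prefix_of_trans HG _ hn); rewrite ez.
  have -> : p ^+ q * s = s * p ^+ q by apply/commute_sym/commuteX/commute_sym.
  by apply: le_mulr; apply: (GpX HG).
rewrite s1 mulg1 in ez.
exists (p ^+ (q %% k)); first by apply: map_f; rewrite mem_iota ltn_mod k0.
exists ((e * (q %/ k))%N%:Z - (e * `|i|)%N%:Z)%R.
rewrite zpowD zpowN !zpow_nat !expgnA -/E.
apply: (mulIg (E ^+ `|i|%N)); rewrite ez -!mulgA mulVg mulg1.
by rewrite {1}(divn_eq q k) addnC expgnDr mulnC expgnA -eE.
Qed.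

End Center.

Local Open Scope ring_scope.
(** * Metric graphs *)
Section GraphModel.
Context (R : realType) (V : Type) (e : V -> V -> Prop).
Context (T : Type) (d : T -> T -> R) (h : T -> V) (C : R).
Hypothesis Hd : coarse_metric 0 d.
Hypothesis C_ge0 : 0 <= C.
Hypothesis h_surj : forall v, exists t, v = h t.
Hypothesis walk_lower : forall n x y, walk e n (h x) (h y) -> d x y <= n%:R + C.
Hypothesis walk_upper : forall x y,
  exists2 n, walk e n (h x) (h y) & n%:R <= d x y + C.

Local Notation vd := (vertex_dist R e).
Local Notation gd := (@graph_dist R V e).

Lemma vertex_dist_coarse x y : `|vd (h x) (h y) - d x y| <= C.
Proof.
have lb n : walk e n (h x) (h y) -> d x y - C <= n%:R.
  by move=> /walk_lower; lra.
have [n hn le_n] := walk_upper x y.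
have h1 : vd (h x) (h y) <= n%:R.
  apply: ge_inf; last by exists n.
  by exists (d x y - C) => _ [k hk <-]; exact: lb.
have h2 : d x y - C <= vd (h x) (h y).
  by apply: lb_le_inf => [|_ [k hk <-]]; [exists n%:R, n|exact: lb].
by rewrite ler_norml; apply/andP; split; lra.
Qed.

Lemma cell_dist u v x y : cell e u v -> u = h x -> v = h y -> d x y <= 1 + C.
Proof.
have C0 := C_ge0; move=> hc eu ev; rewrite eu ev in hc; case: hc => [e0|hadj].
  by have := @walk_lower 0 x y e0; lra.
by apply: (@walk_lower 1); exists (h y).
Qed.

Lemma cell_sym u v : cell e u v -> cell e v u.
Proof. by move=> [->|[h1|h1]]; [left|right; right|right; left]. Qed.

Lemma on_segment_pos u v (x : V -> R) a : on_segment u v x -> 0 < x a ->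
  a = u \/ a = v.
Proof.
move=> [t [ht hx]]; rewrite hx.
case: (asboolP (a = u)) => [|_]; first by left.
case: (asboolP (a = v)) => [|_]; first by right.
by rewrite !mulr0 addr0 ltxx.
Qed.

Lemma on_segment_le1 u v (x : V -> R) a : on_segment u v x -> 0 <= x a <= 1.
Proof.
move=> [t [ht hx]]; rewrite hx.
by case: asboolP => _; case: asboolP => _ /=; lra.
Qed.

Lemma graph_point_support (x : metric_graph R e) : exists a, 0 < sval x a.
Proof.
have [u [v [_ [t [ht hx]]]]] := svalP x.
have [t1|t1] := ltP t 1.
  by exists u; rewrite hx asboolT //; case: asboolP => _ /=; lra.
by exists v; rewrite hx (asboolT (erefl v)); case: asboolP => _ /=; lra.
Qed.

Lemma segment_dist u v (x : V -> R) s t : cell e u v -> on_segment u v x ->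
  0 < x (h s) -> 0 < x (h t) -> d s t <= 1 + C.
Proof.
move=> hc hx hs ht.
have [es|es] := on_segment_pos hx hs; have [et|et] := on_segment_pos hx ht.
- by apply: (@cell_dist u u) => //; left.
- by apply: (@cell_dist u v).
- by apply: (@cell_dist v u) => //; apply: cell_sym.
- by apply: (@cell_dist v v) => //; left.
Qed.

(** Each point of the graph is within distance 1 of the vertices in its support,
    and any two of these vertices are joined by an edge or equal. *)
Lemma graph_dist_coarse (x y : metric_graph R e) s t :
  0 < sval x (h s) -> 0 < sval y (h t) -> `|gd x y - d s t| <= 3 * C + 3.
Proof.
have [_ d0 dxx dsym dtri] := Hd.
have C0 := C_ge0.
move=> hs ht.
have [u [v [xc xs]]] := svalP x; have [u' [v' [yc ys]]] := svalP y.
rewrite /graph_dist; set cand := (X in inf X).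
have lb (r : R) : cand r -> d s t - 3 * C - 3 <= r.
  move=> [[u1 [v1 [hc1 hx1 hy1 ->]]]|[a [b [ha hb ->]]]].
    suff hst : d s t <= 1 + C.
      have h0 : d s t - 3 * C - 3 <= 0 by lra.
      exact: le_trans h0 (normr_ge0 _).
    have [es|es] := on_segment_pos hx1 hs; have [et|et] := on_segment_pos hy1 ht.
    - by apply: (@cell_dist u1 u1) => //; left.
    - by apply: (@cell_dist u1 v1).
    - by apply: (@cell_dist v1 u1) => //; apply: cell_sym.
    - by apply: (@cell_dist v1 v1) => //; left.
  have [s' es'] := h_surj a; have [t' et'] := h_surj b.
  rewrite es' in ha *; rewrite et' in hb *.
  have h1 := segment_dist xc xs hs ha; have h2 := segment_dist yc ys hb ht.
  have := vertex_dist_coarse s' t'; rewrite ler_norml => /andP[h3 h4].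
  have := on_segment_le1 (h s') xs; have := on_segment_le1 (h t') ys.
  have := dtri s' s t; have := dtri t' s' t; lra.
have Sst : cand ((1 - sval x (h s)) + vd (h s) (h t) + (1 - sval y (h t))).
  by right; exists (h s), (h t).
have h1 : inf cand <= (1 - sval x (h s)) + vd (h s) (h t) + (1 - sval y (h t)).
  by apply: ge_inf => //; exists (d s t - 3 * C - 3) => r; apply: lb.
have h2 : d s t - 3 * C - 3 <= inf cand.
  by apply: lb_le_inf; [eexists; exact: Sst|exact: lb].
have := vertex_dist_coarse s t; rewrite ler_norml => /andP[h3 h4].
have := on_segment_le1 (h s) xs; have := on_segment_le1 (h t) ys.
by rewrite ler_norml => ? ?; apply/andP; split; lra.
Qed.

Lemma graph_model : exists (K : R) (f : metric_graph R e -> T),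
  [/\ coarse_metric K gd, coarse_metric K d,
      forall x y, `|gd x y - d (f x) (f y)| <= K,
      forall s t, `|gd (vertex R e (h s)) (vertex R e (h t)) - d s t| <= K &
      forall t, d (f (vertex R e (h t))) t <= K].
Proof.
have C0 := C_ge0; have [_ d0 dxx dsym dtri] := Hd.
have /choice[f hf] : forall x : metric_graph R e, exists t, 0 < sval x (h t).
  move=> x; have [a ha] := graph_point_support x; have [t et] := h_surj a.
  by exists t; rewrite -et.
have vpos t : 0 < sval (vertex R e (h t)) (h t) by rewrite /= asboolT.
pose K := 10 * C + 10; exists K, f.
have hgd x y : `|gd x y - d (f x) (f y)| <= 3 * C + 3.
  exact: graph_dist_coarse (hf x) (hf y).
have hgd' x y : d (f x) (f y) - (3 * C + 3) <= gd x y <= d (f x) (f y) + (3 * C + 3).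
  by move: (hgd x y); rewrite ler_norml; lra.
split.
- rewrite /K; split=> [|x y|x|x y|y x z]; first by lra.
  + by have := hgd' x y; have := d0 (f x) (f y); lra.
  + by have := hgd' x x; have := dxx (f x); lra.
  + by have := hgd' x y; have := hgd' y x; have := dsym (f x) (f y); lra.
  + have := hgd' x z; have := hgd' x y; have := hgd' y z.
    by have := dtri (f y) (f x) (f z); lra.
- rewrite /K; split=> [|x y|x|x y|y x z]; first by lra.
  + by have := d0 x y; lra.
  + by have := dxx x; lra.
  + by have := dsym x y; lra.
  + by have := dtri y x z; lra.
- by move=> x y; have := hgd x y; rewrite /K; lra.
- by move=> s t; have := graph_dist_coarse (vpos s) (vpos t); rewrite /K; lra.
- move=> t; have := @segment_dist (h t) (h t) _ (f (vertex R e (h t))) t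
    (or_introl erefl) _ (hf (vertex R e (h t))) (vpos t).
  have : on_segment (h t) (h t) (sval (vertex R e (h t))).
    exists 0; rewrite lexx ler01; split => // w.
    by rewrite subr0 mul1r mul0r addr0.
  by move=> h1 /(_ h1); rewrite /K; lra.
Qed.

Lemma graph_morse (gamma : int -> T) :
  morse gd (fun k => vertex R e (h (gamma k))) <-> morse d gamma.
Proof.
have [K [f [hgd hd h1 h2 h3]]] := graph_model.
split.
  apply: (morse_transfer hgd hd (f := fun t => vertex R e (h t))) => [x y|k].
    exact: h2.
  by have [_ _ + _ _] := hgd; apply.
apply: (morse_transfer hd hgd (f := f)) => [x y|k].
  by rewrite distrC.
exact: h3.
Qed.

Lemma graph_strongly_contracting (gamma : int -> T) :
  strongly_contracting d (range gamma) ->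
  strongly_contracting gd (range (fun k => vertex R e (h (gamma k)))).
Proof.
have [K [f [hgd hd h1 h2 h3]]] := graph_model.
apply: (strongly_contracting_transfer hgd hd (f := f)) => [x y|k].
  by rewrite distrC.
exact: h3.
Qed.

End GraphModel.

Local Open Scope group_scope.

Section Cosets.
Context (G : groupType) (H : set G).
Hypothesis HH : is_subgroup H.

Lemma coset_eqP x y : coset_of H x = coset_of H y <-> H (x^-1 * y).
Proof.
have [[H1 HM] HV] := HH; split.
  move=> /(congr1 sval) /= e.
  have : left_coset H y y by exists 1 => //; rewrite mulg1.
  by rewrite -e => -[z hz <-]; rewrite mulKg.
move=> hxy; apply: eq_exist => /=; apply/seteqP; split => _ [z hz <-].
  exists (y^-1 * x * z); last by group_simp.
  by apply: HM => //; have := HV _ hxy; group_simp.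
exists (x^-1 * y * z); last by group_simp.
exact: HM.
Qed.

Lemma coset_mem (v : cosets H) x : sval v x -> v = coset_of H x.
Proof.
case: v => A [y hA] /= hx; subst A; have [z hz exz] := hx.
apply: (@etrans _ _ (coset_of H y)); first exact: eq_exist.
by apply/coset_eqP; rewrite -exz mulKg.
Qed.

Lemma coset_surj (v : cosets H) : exists x, v = coset_of H x.
Proof.
case: v => A [y hA]; exists y; exact: eq_exist.
Qed.

End Cosets.

(** * Distances in the two graphs of a Garside group *)
Section GarsideGraphs.
Context (R : realType) (G : groupType) (Gp : set G) (Delta : G).
Hypothesis HG : garside_structure Gp Delta.
Hypothesis Hfin : finite_type Gp Delta.
Hypothesis Delta_neq1 : Delta <> 1.
Local Notation le := (prefix_of Gp).
Local Notation D := (zpow Delta).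
Local Notation simple := (simple_elements Gp Delta).

Inductive simple_path : nat -> G -> G -> Prop :=
| simple_path_nil x : simple_path 0 x x
| simple_path_snoc n x y s :
    simple_path n x y -> simple s -> simple_path n.+1 x (y * s).

Lemma simple_path_walk V (e : V -> V -> Prop) (h : G -> V) n x y :
  (forall x s, simple s -> h x = h (x * s) \/ adjacent e (h x) (h (x * s))) ->
  simple_path n x y -> exists2 m, (m <= n)%N & walk e m (h x) (h y).
Proof.
move=> hs; elim=> [u|{}n {}x {}y s _ [m hm hw] ss]; first by exists 0%N.
have [<-|hadj] := hs y s ss; first by exists m => //; apply: ltnW.
exists m.+1 => //.
elim: m (h x) hw {hm} => [v /= -> //|m IH v /= [w h1 h2]]; last first.
  by exists w => //; apply: IH.
by exists (h (y * s)).
Qed.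

Lemma simple_Delta : simple Delta.
Proof. by split; [exact: Gp_Delta HG|exact: prefix_of_refl HG Delta]. Qed.

Lemma cyclic_subgroup_group : is_subgroup (cyclic_subgroup Delta).
Proof.
split; first split.
- by exists 0%R.
- by move=> _ _ [i _ <-] [j _ <-]; exists (i + j)%R => //; rewrite zpowD.
- by move=> _ [i _ <-]; exists (- i)%R => //; rewrite zpowN.
Qed.

Lemma center_group : is_subgroup (@center G).
Proof.
split; first split.
- by move=> x; rewrite mul1g mulg1.
- by move=> x y hx hy z; rewrite -mulgA hy !mulgA hx.
- by move=> x hx z; apply: (mulgI x); rewrite mulVKg mulgA hx mulgK.
Qed.

Section WithLattice.
Context (A : asymLattice G).
Hypothesis shiftE : forall x k, shift A x k = x * D k.
Hypothesis adistE : forall x y (b : int), (adist A x y <= b)%R <-> le y (x * D b).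
Hypothesis adistM : forall z x y, adist A (z * x) (z * y) = adist A x y.
Local Notation d := (sdist A).

Lemma sdist_shift x k : d x (x * D k) = 0%R.
Proof.
by rewrite /sdist -shiftE adist_shiftl adist_shiftr adist_self; lia.
Qed.

Lemma sdist_shiftr x y k : d x (y * D k) = d x y.
Proof. by rewrite /sdist -shiftE adist_shiftl adist_shiftr; lia. Qed.

Lemma sdistM z x y : d (z * x) (z * y) = d x y.
Proof. by rewrite /sdist !adistM. Qed.

Lemma sdist_simple x s : simple s -> (d x (x * s)%g <= 1)%R.
Proof.
move=> [s1 s2].
have h1 : (adist A x (x * s)%g <= 1)%R by apply/adistE; apply/le_mul2l.
have h2 : (adist A (x * s)%g x <= 0)%R.
  by apply/adistE; rewrite zpow0 mulg1; apply: le_mulr.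
by rewrite /sdist; lia.
Qed.

(** Consecutive points of the geodesic [geo A x y] differ by a simple element on
    the right. *)
Lemma sdist_simple_path x y : exists k, simple_path `|d x y|%N x (y * D k).
Proof.
have d0 := sdist_ge0 A x y.
have adist0 u v : (adist A u v <= 0)%R -> le v u.
  by move=> /adistE; rewrite zpow0 mulg1.
have start : geo A x y 0%N%:Z = x.
  have [|e1 e2 _ _] := @geoP _ A x y 0%N%:Z; first by lia.
  by apply: (prefix_of_anti HG); apply: adist0; lia.
have finish : geo A x y `|d x y|%N%:Z = y * D (adist A y x).
  have [|_ _ e3 e4] := @geoP _ A x y `|d x y|%N%:Z; first by lia.
  apply: (prefix_of_anti HG); apply: adist0; rewrite -shiftE ?adist_shiftl ?adist_shiftr.
    by lia.
  by rewrite e4; move: d0; rewrite /sdist; lia.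
exists (adist A y x); rewrite -finish.
suff key n : (n <= `|d x y|)%N -> simple_path n x (geo A x y n%:Z) by apply: key.
elim: n => [_|n IH hn]; first by rewrite start; left.
have [|||e1 e2] := @adist_geo _ A x y n%:Z n.+1%:Z; [lia..|].
rewrite -(mulVKg (geo A x y n%:Z) (geo A x y n.+1%:Z)).
apply: simple_path_snoc; first by apply: IH; apply: ltnW.
split; first by apply: adist0; rewrite e2.
apply/(le_mul2l Gp (geo A x y n%:Z)); rewrite mulVKg -[X in _ * X](zpow1 Delta).
by apply/adistE; rewrite e1; lia.
Qed.

(** Edges are lifted to the group one after the other, so that no error
    accumulates from changing representatives of the vertices. *)
Lemma walk_sdist V (e : V -> V -> Prop) (h : G -> V) :
  (forall x w, adjacent e (h x) w -> exists2 x', w = h x' & (d x x' <= 1)%R) ->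
  forall n x v, walk e n (h x) v -> exists2 y, v = h y & (d x y <= n%:Z)%R.
Proof.
move=> hadj; elim=> [x v /= <-|n IH x v /= [w h1 h2]].
  by exists x => //; rewrite sdistxx.
have [x' ew dx'] := hadj _ _ h1; rewrite ew in h2.
have [y ev dy] := IH _ _ h2; exists y => //.
by have := sdist_triangle A x' x y; lia.
Qed.

(** The distinguished representative enters only as some multiple of [x0] by a
    power of [Delta]. *)
Lemma X_edge_lift x w :
  adjacent (@X_edge G Gp Delta) (coset_of _ x) w ->
  exists2 x', w = coset_of _ x' & (d x x' <= 1)%R.
Proof.
have HD := cyclic_subgroup_group.
move=> [[x0 [s [ex ss _ hw]]]|[x0 [s [ew ss _ hx]]]].
  have [i _ ei] := (coset_eqP HD _ _).1 ex.
  exists (distinguished Gp Delta x0 * s); first exact: coset_mem.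
  rewrite /distinguished; move: (- _)%R => j.
  have -> : x0 = x * D i by rewrite ei mulVKg.
  have e : x * D i * D j = x * D (i + j)%R by rewrite zpowD mulgA.
  rewrite e; have := sdist_simple (x * D (i + j)%R) ss.
  have := sdist_triangle A (x * D (i + j)%R) x (x * D (i + j)%R * s).
  by rewrite sdist_shift; lia.
exists x0 => //.
have [i _ ei] := (coset_eqP HD _ _).1 (coset_mem HD hx).
have -> : x = distinguished Gp Delta x0 * s * D (- i)%R.
  by rewrite zpowN ei; group_simp.
rewrite sdistC sdist_shiftr /distinguished; move: (- _)%R => j.
have := sdist_simple (x0 * D j) ss.
have := sdist_triangle A (x0 * D j) x0 (x0 * D j * s).
by rewrite sdist_shift; lia.
Qed.

Lemma X_edge_simple x s : simple s ->
  coset_of (cyclic_subgroup Delta) x = coset_of _ (x * s) \/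
  adjacent (@X_edge G Gp Delta) (coset_of _ x) (coset_of _ (x * s)).
Proof.
have HD := cyclic_subgroup_group.
move=> ss; have [->|s1] := pselect (s = 1); first by left; rewrite mulg1.
have [->|sD] := pselect (s = Delta).
  by left; apply/(coset_eqP HD); rewrite mulKg; exists 1%R.
right; left; exists x, (s ^ D (- garside_inf Gp Delta x)%R).
have DeltaJ k : Delta ^ D k = Delta.
  by rewrite conjgE (commute_zpow k (erefl (Delta * Delta))) mulKg.
have conj_simple k : simple (s ^ D k).
  have [h1 h2] := ss; split; first exact: (Gp_conj_zpow HG).
  rewrite -[X in le _ X](DeltaJ k) /prefix_of -conjVg -conjMg.
  exact: (Gp_conj_zpow HG).
split => //.
- split.
    by move=> /(congr1 (fun y => y ^ (D (- garside_inf Gp Delta x)%R)^-1));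
      rewrite conjgK conj1g; exact: s1.
  move=> /(congr1 (fun y => y ^ (D (- garside_inf Gp Delta x)%R)^-1)).
  by rewrite conjgK -zpowN DeltaJ; exact: sD.
- exists (D (- garside_inf Gp Delta x)%R); first by exists (- garside_inf Gp Delta x)%R.
  by rewrite /distinguished conjgE !zpowN; group_simp.
Qed.

Lemma X_walk_lower n x y :
  walk (@X_edge G Gp Delta) n (coset_of _ x) (coset_of _ y) -> (d x y <= n%:Z)%R.
Proof.
move=> /(walk_sdist X_edge_lift)[y' ey h].
have [i _ ei] := (coset_eqP cyclic_subgroup_group _ _).1 ey.
have -> : y = y' * D (- i)%R by rewrite zpowN ei; group_simp.
by rewrite sdist_shiftr.
Qed.

Lemma X_walk_upper x y : exists2 n,
  walk (@X_edge G Gp Delta) n (coset_of _ x) (coset_of _ y) & (n%:Z <= d x y)%R.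
Proof.
have [k hk] := sdist_simple_path x y.
have [m hm hw] := simple_path_walk X_edge_simple hk.
have ey : coset_of (cyclic_subgroup Delta) (y * D k) = coset_of _ y.
  by apply/esym/(coset_eqP cyclic_subgroup_group); rewrite mulKg; exists k.
exists m; first by rewrite -ey.
by have := sdist_ge0 A x y; lia.
Qed.

Lemma cayley_edge_lift x w :
  adjacent (@cayley_edge G Gp Delta) (coset_of _ x) w ->
  exists2 x', w = coset_of _ x' & (d x x' <= 1)%R.
Proof.
have HZ := center_group.
move=> [[x0 [s [ss ex ->]]]|[x0 [s [ss -> ex]]]].
  have hz := (coset_eqP HZ _ _).1 ex.
  exists (x * s); last exact: sdist_simple.
  apply/esym/(coset_eqP HZ).
  have -> : (x * s)^-1 * (x0 * s) = x^-1 * x0.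
    by rewrite invgM -mulgA (mulgA x^-1) hz mulKg.
  exact: hz.
have hz := (coset_eqP HZ _ _).1 ex.
exists (x * s^-1).
  apply/esym/(coset_eqP HZ).
  have -> : (x * s^-1)^-1 * x0 = x^-1 * (x0 * s).
    have e : x^-1 * x0 = s^-1 * (x^-1 * (x0 * s)) by rewrite -hz; group_simp.
    by rewrite invgM invgK -mulgA e mulVKg.
  exact: hz.
have := sdist_simple (x * s^-1) ss.
by rewrite mulgVK sdistC.
Qed.

Hypothesis Hpure : Delta_pure Gp.

Lemma center_bounded : exists C : int, (0 <= C)%R /\
  forall x z, center z -> (d x (x * z)%g <= C)%R.
Proof.
have [l hl] := center_finite_mod_Delta HG Hfin Hpure Delta_neq1.
have [C [C0 HC]] : exists C : int, (0 <= C)%R /\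
    forall y, y \in l -> (d 1%g y <= C)%R.
  elim: l {hl} => [|y l [C [C0 HC]]]; first by exists 0%R.
  exists (C + d 1%g y)%R; have d0 := sdist_ge0 A 1%g y; split; first by lia.
  by move=> y'; rewrite inE => /orP[/eqP ->|/HC]; lia.
exists C; split => // x z /hl[y yl [m ->]].
by rewrite -{1}[x]mulg1 sdistM sdist_shiftr; apply: HC.
Qed.

Lemma cayley_walk_lower : exists C : int, (0 <= C)%R /\ forall n x y,
  walk (@cayley_edge G Gp Delta) n (coset_of _ x) (coset_of _ y) ->
  (d x y <= n%:Z + C)%R.
Proof.
have [C [C0 HC]] := center_bounded; exists C; split => // n x y.
move=> /(walk_sdist cayley_edge_lift)[y' ey h].
have := (coset_eqP center_group _ _).1 (esym ey).
move=> /(HC y'); rewrite mulVKg.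
by have := sdist_triangle A y' x y; lia.
Qed.

(** A chain of simple elements from [x] ends at a multiple of [y] by a power of
    [Delta].  Fewer than [e] further factors [Delta] make the exponent a multiple
    of [e], so that the end is in the class of [y] modulo the center. *)
Lemma cayley_walk_upper : exists C : int, (0 <= C)%R /\ forall x y, exists2 n,
  walk (@cayley_edge G Gp Delta) n (coset_of _ x) (coset_of _ y) &
  (n%:Z <= d x y + C)%R.
Proof.
have [e [e0 he]] := Delta_power_central HG Hfin.
exists e%:Z; split => // x y.
have [k hk] := sdist_simple_path x y.
have powers n u v j : simple_path n u v -> simple_path (n + j) u (v * Delta ^+ j).
  move=> h; elim: j => [|j IH]; first by rewrite addn0 mulg1.
  by rewrite addnS expgSr mulgA; apply: simple_path_snoc IH simple_Delta.
pose j := `|((- k) %% e%:Z)%Z|%N.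
have hj : (j%:Z = ((- k) %% e%:Z)%Z)%R.
  by rewrite /j gez0_abs // modz_ge0 // -lt0n.
have je : (j < e)%N.
  by rewrite -ltz_nat hj ltz_pmod // ltz_nat.
have [q hq] : exists q : int, (k + j%:Z = q * e%:Z)%R.
  exists (- ((- k) %/ e%:Z)%Z)%R; rewrite hj.
  by have := divz_eq (- k)%R e%:Z; lia.
have cs u s : simple s -> coset_of (@center G) u = coset_of _ (u * s) \/
    adjacent (@cayley_edge G Gp Delta) (coset_of _ u) (coset_of _ (u * s)).
  by move=> ss; right; left; exists u, s.
have [m hm hw] := simple_path_walk cs (powers _ _ _ j hk).
exists m; last by have := sdist_ge0 A x y; lia.
suff -> : coset_of (@center G) y = coset_of _ (y * D k * Delta ^+ j) by [].
apply/(coset_eqP center_group); rewrite -mulgA mulKg -(zpow_nat Delta j) -zpowD hq.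
move=> u; rewrite mulrC; apply/esym.
have -> : D (e%:Z * q)%R = zpow (Delta ^+ e) q.
  case: q {hq} => n; first by rewrite zpowM zpow_nat.
  by rewrite NegzE mulrN !zpowN zpowM zpow_nat.
exact: commute_zpow.
Qed.

End WithLattice.

Hypothesis Hpure : Delta_pure Gp.

(** Comparing each graph with the same pseudo-distance on the group also relates
    the two graphs to each other. *)
Lemma axis_transfer : exists2 A : asymLattice G,
  (forall gamma : int -> G,
    (morse (@dist_X G Gp Delta R) (fun k => vertex R _ (coset_of _ (gamma k))) <->
     morse (rdist R A) gamma) /\
    (morse (@dist_Gamma_bar G Gp Delta R) (fun k => vertex R _ (coset_of _ (gamma k))) <->
     morse (rdist R A) gamma)) &
  (forall gamma : int -> G, strongly_contracting (rdist R A) (range gamma) ->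
    strongly_contracting (@dist_X G Gp Delta R)
      (range (fun k => vertex R _ (coset_of _ (gamma k)))) /\
    strongly_contracting (@dist_Gamma_bar G Gp Delta R)
      (range (fun k => vertex R _ (coset_of _ (gamma k))))).
Proof.
have [A [hA1 hA2 hA3]] := garside_asymLattice HG Delta_neq1.
have hd := @coarse_metric_rdist R G A 0%R (lexx 0%R).
have [C1 [C10 HC1]] := cayley_walk_lower hA1 hA2 hA3 Hpure.
have [C2 [C20 HC2]] := cayley_walk_upper hA1 hA2.
have hX1 n x y : walk (@X_edge G Gp Delta) n (coset_of _ x) (coset_of _ y) ->
    (rdist R A x y <= n%:R + 0)%R.
  move=> h; have := X_walk_lower hA1 hA2 h.
  by rewrite -(ler_int R) addr0.
have hX2 x y : exists2 n, walk (@X_edge G Gp Delta) n (coset_of _ x) (coset_of _ y) &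
    (n%:R <= rdist R A x y + 0)%R.
  have [n h1 h2] := X_walk_upper hA1 hA2 x y; exists n => //.
  by move: h2; rewrite -(ler_int R) addr0.
pose C : R := (C1 + C2)%:~R.
have C0 : (0 <= C)%R by rewrite ler0z addr_ge0.
have hG1 n x y : walk (@cayley_edge G Gp Delta) n (coset_of _ x) (coset_of _ y) ->
    (rdist R A x y <= n%:R + C)%R.
  move=> h; have := HC1 _ _ _ h => h1.
  have : (sdist A x y <= n%:Z + (C1 + C2))%R by lia.
  by rewrite -(ler_int R) intrD.
have hG2 x y : exists2 n, walk (@cayley_edge G Gp Delta) n (coset_of _ x) (coset_of _ y) &
    (n%:R <= rdist R A x y + C)%R.
  have [n h1 h2] := HC2 x y; exists n => //.
  have : (n%:Z <= sdist A x y + (C1 + C2))%R by lia.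
  by rewrite -(ler_int R) intrD.
exists A => gamma.
  split; first exact: (graph_morse hd (lexx 0%R) (@coset_surj _ _) hX1 hX2).
  exact: (graph_morse hd C0 (@coset_surj _ _) hG1 hG2).
move=> hsc; split.
  exact: (graph_strongly_contracting hd (lexx 0%R) (@coset_surj _ _) hX1 hX2).
exact: (graph_strongly_contracting hd C0 (@coset_surj _ _) hG1 hG2).
Qed.

End GarsideGraphs.

Lemma not_morse_constant (R : realType) X (d : X -> X -> R) (gamma : int -> X) x :
  (forall k, gamma k = x) -> ~ morse d gamma.
Proof.
move=> hx [[L [K [L1 K0 h]]] _].
have h0 : (0 <= d x x + K)%R.
  by have /andP[] := h 0%R 0%R; rewrite !hx subrr normr0 mulr0 => ? _; lra.
have m0 : (0 <= L * (d x x + K))%R by apply: mulr_ge0 => //; lra.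
have hn := archi_boundP m0; move: (Num.bound _) hn => n hn.
have /andP[h1 _] := h n%:Z 0%R; rewrite !hx subr0 /= -pmulrn in h1.
rewrite lerBlDr ler_pdivrMl in h1; last by lra.
by have := lt_le_trans hn h1; rewrite ltxx.
Qed.

(** The case [Delta = 1] has to be treated apart, since then no power of [Delta]
    is least; both axes are constant in it, hence not Morse. *)
Lemma trivial_of_Delta_eq1 (G : groupType) (Gp : set G) (Delta : G) :
  garside_structure Gp Delta -> Delta = 1 -> forall x : G, x = 1.
Proof.
move=> HG D1 x.
have : smallest (@is_subgroup G) (simple_elements Gp Delta) `<=` [set 1].
  apply: smallest_sub => [|s [h1]].
    split; first split; first by [].
      by move=> y z /= -> ->; rewrite mulg1.
    by move=> y /= ->; rewrite invg1.
  by rewrite /prefix_of D1 mulg1; exact: (Gp_inv_eq1 HG h1).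
by rewrite (garside_gen_group HG); apply.
Qed.

Theorem theorem1p1 (R : realType) (G : groupType) (Gp : set G) (Delta : G)
    (HG : garside_structure Gp Delta)
    (Hfin : finite_type Gp Delta)
    (Hpure : Delta_pure Gp)
    (g : G) :
  (morse (@dist_X G Gp Delta R) (axis_X Gp Delta R g) <->
   morse (@dist_Gamma_bar G Gp Delta R) (axis_Gamma_bar Gp Delta R g)) /\
  (morse (@dist_X G Gp Delta R) (axis_X Gp Delta R g) ->
   strongly_contracting (@dist_X G Gp Delta R) (range (axis_X Gp Delta R g)) /\
   strongly_contracting (@dist_Gamma_bar G Gp Delta R)
     (range (axis_Gamma_bar Gp Delta R g))).
Proof.
have [D1|D1] := pselect (Delta = 1).
  have triv := trivial_of_Delta_eq1 HG D1.
  have nX : ~ morse (@dist_X G Gp Delta R) (axis_X Gp Delta R g).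
    by apply: (@not_morse_constant _ _ _ _ (axis_X Gp Delta R g 0%R)) => k;
      rewrite /axis_X (triv (zpow g k)) (triv (zpow g 0%R)).
  have nG : ~ morse (@dist_Gamma_bar G Gp Delta R) (axis_Gamma_bar Gp Delta R g).
    by apply: (@not_morse_constant _ _ _ _ (axis_Gamma_bar Gp Delta R g 0%R)) => k;
      rewrite /axis_Gamma_bar (triv (zpow g k)) (triv (zpow g 0%R)).
  by split; [split|].
have [A hmorse hsc] := axis_transfer R HG Hfin D1 Hpure.
have [mX mG] := hmorse (zpow g).
split; first by split=> [/mX/mG|/mG/mX].
move=> /mX /coarse_morse_rdist /(strongly_contracting_rdist R).
exact: hsc.
Qed.
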